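(* Let $N\ge 1$ and $n\ge 1$ be integers and let $f_1,\dots,f_n\in L^1(\mathbb{R}^N)$ be real-valued. Then there exists a real-valued function $g\in C_c^{\infty}(\mathbb{R}^1)$ such that $$\int_{\mathbb{R}^N} f_j(x)\,e^{ig(x_1)}\,dx=0\qquad\text{for all } 1\le j\le n,$$ where $x_1$ denotes the first coordinate of $x=(x_1,\dots,x_N)\in\mathbb{R}^N$.
   Context: $L^1(\mathbb{R}^N)$ is the space of Lebesgue-integrable functions on $\mathbb{R}^N$. $C_c^\infty(\mathbb{R}^1)$ denotes the infinitely differentiable functions on the real line with compact support. *)

(* Defs.v *)
From HB Require Import structures.
From mathcomp Require Import all_boot all_order all_algebra.
From mathcomp Require Import all_classical all_reals all_analysis.
From mathcomp Require Import complex.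
Set Implicit Arguments.
Unset Strict Implicit.
Unset Printing Implicit Defensive.
Import Order.TTheory GRing.Theory Num.Theory.
Import numFieldNormedType.Exports.
Local Open Scope classical_set_scope.
Local Open Scope ring_scope.

Section lebesgue_tuple.
Context {R : realType}.
Local Open Scope ereal_scope.
Local Notation RB := (measurableTypeR R).

Definition cons_pair N (p : RB * N.-tuple RB) : N.+1.-tuple RB :=
  [the N.+1.-tuple RB of p.1 :: p.2].

Lemma measurable_cons_pair N : measurable_fun setT (@cons_pair N).
Proof. exact: measurable_cons. Qed.

Section lebesgue_cons.
Variables (N : nat) (mu : {sigma_finite_measure set (N.-tuple RB) -> \bar R}).

Let nu : {measure set (RB * N.-tuple RB)%type -> \bar R} :=
  @lebesgue_measure R \x mu.

Definition lebesgue_cons : set (N.+1.-tuple RB) -> \bar R :=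
  pushforward (@lebesgue_measure R \x mu) (@cons_pair N).

Let lebesgue_cons0 : lebesgue_cons set0 = 0.
Proof. by rewrite /lebesgue_cons /pushforward preimage_set0 (measure0 nu). Qed.

Let lebesgue_cons_ge0 A : 0 <= lebesgue_cons A.
Proof. exact: (measure_ge0 nu). Qed.

Let lebesgue_cons_sigma_additive : semi_sigma_additive lebesgue_cons.
Proof.
have mcons A : measurable A -> measurable (@cons_pair N @^-1` A).
  by move=> mA; rewrite -[X in measurable X]setTI; exact: measurable_cons_pair.
move=> F mF tF mUF; rewrite /lebesgue_cons /pushforward preimage_bigcup.
apply: (@measure_semi_sigma_additive _ _ _ nu).
- by move=> i; exact: mcons.
- apply/trivIsetP => /= i j _ _ ij; rewrite -preimage_setI.
  by move/trivIsetP : tF => /(_ _ _ _ _ ij) ->//; rewrite preimage_set0.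
- by rewrite -preimage_bigcup; exact: mcons.
Qed.

HB.instance Definition _ := isMeasure.Build _ _ _ lebesgue_cons
  lebesgue_cons0 lebesgue_cons_ge0 lebesgue_cons_sigma_additive.

Let lebesgue_cons_sigma_finite : sigma_finite setT lebesgue_cons.
Proof.
have /sigma_finiteP[F [TF ndF Foo]] := sigma_finiteT (@lebesgue_measure R).
have /sigma_finiteP[G [TG ndG Goo]] := sigma_finiteT mu.
pose dec (t : N.+1.-tuple RB) : (RB * N.-tuple RB)%type :=
  (thead t, [tuple of behead t]).
have mdec : measurable_fun setT dec.
  by apply: measurable_fun_pair;
    [exact: measurable_tnth | exact: measurable_behead].
exists (fun i => dec @^-1` (F i `*` G i)).
  rewrite -preimage_bigcup; apply/esym/seteqP; split => // t _.
  have [k _ Fk] : (\bigcup_i F i) (dec t).1 by rewrite -TF.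
  have [l _ Gl] : (\bigcup_i G i) (dec t).2 by rewrite -TG.
  exists (maxn k l) => //; split.
    by move: Fk; apply/subsetPset/ndF/leq_maxl.
  by move: Gl; apply/subsetPset/ndG/leq_maxr.
move=> i; have [mFi Fioo] := Foo i; have [mGi Gioo] := Goo i; split.
  by rewrite -[X in measurable X]setTI; apply: mdec => //; exact: measurableX.
rewrite /lebesgue_cons /pushforward -comp_preimage.
rewrite (_ : dec \o _ = id).
  by rewrite preimage_id product_measure1E// lte_mul_pinfty// ge0_fin_numE.
apply/funext => -[x t] /=; rewrite /dec /cons_pair /=; congr pair.
by apply/val_inj.
Qed.

HB.instance Definition _ := Measure_isSigmaFinite.Build _ _ _ lebesgue_cons
  lebesgue_cons_sigma_finite.

End lebesgue_cons.

(* The N-fold product of the Borel Lebesgue measure, R^(N+1) being identified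
   with R * R^N; R^0 is a single point of mass 1. *)
Fixpoint lebesgue_tuple (N : nat) :
    {sigma_finite_measure set (N.-tuple RB) -> \bar R} :=
  if N is M.+1 then lebesgue_cons (lebesgue_tuple M) else \d_[tuple].

Lemma measurable_box N (A : 'I_N -> set RB) :
  (forall i, measurable (A i)) ->
  measurable [set t : N.-tuple RB | forall i, A i (tnth t i)].
Proof.
move=> mA; rewrite (_ : [set _ | _] =
    \bigcap_(i in [set: 'I_N]) ((@tnth _ RB ^~ i) @^-1` A i)).
  apply: fin_bigcap_measurable => // i _; rewrite -[X in measurable X]setTI.
  exact: measurable_tnth.
by apply/seteqP; split => t /= At i; [move=> _; exact: At | exact: At].
Qed.

Lemma lebesgue_tuple_box N (A : 'I_N -> set RB) :
  (forall i, measurable (A i)) ->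
  lebesgue_tuple N [set t | forall i, A i (tnth t i)] =
  \prod_(i < N) lebesgue_measure (A i).
Proof.
elim: N A => [|N IH] A mA /=.
  by rewrite big_ord0 diracE mem_set// => -[].
rewrite big_ord_recl -(IH (fun i => A (lift ord0 i))); last by move=> i; exact: mA.
rewrite /lebesgue_cons /pushforward -product_measure1E//; last first.
  by apply: (@measurable_box N (fun i => A (lift ord0 i))) => i; exact: mA.
congr (_ _); apply/seteqP; split => -[x t] /=.
  move=> Axt; split => [|i]; first exact: (Axt ord0).
  by have := Axt (lift ord0 i); rewrite tnthS.
move=> [Ax At] i; have [j ->|->//] := unliftP ord0 i.
by rewrite tnthS; exact: At.
Qed.

(* A measure on the Caratheodory sigma-algebra, i.e. the Lebesgue measurable
   (not only the Borel) subsets of R^N. *)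
Definition lebesgueN (N : nat) :=
  @completed_measure_extension _ _ _ (lebesgue_tuple N).
Arguments lebesgueN N _ : clear implicits.

HB.instance Definition _ (N : nat) := Measure.on (lebesgueN N).

Lemma lebesgueN_box N (A : 'I_N -> set RB) :
  (forall i, measurable (A i)) ->
  lebesgueN N [set t | forall i, A i (tnth t i)] =
  \prod_(i < N) lebesgue_measure (A i).
Proof.
move=> mA; rewrite -lebesgue_tuple_box//.
exact: (measurable_mu_extE (lebesgue_tuple N) (measurable_box mA)).
Qed.

Lemma lebesgueN_complete N : measure_is_complete (lebesgueN N).
Proof. exact: measure_is_complete_caratheodory. Qed.

End lebesgue_tuple.
Arguments lebesgueN {R} N _.

Section complex_valued.
Context {R : realType}.
Local Open Scope complex_scope.

Definition cexp (z : R[i]) : R[i] :=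
  (expR (complex.Re z) * cos (complex.Im z)) +i*
  (expR (complex.Re z) * sin (complex.Im z)).

Definition Cintegral d (T : measurableType d) (mu : {measure set T -> \bar R})
    (D : set T) (h : T -> R[i]) : R[i] :=
  (\int[mu]_(x in D) complex.Re (h x)) +i* (\int[mu]_(x in D) complex.Im (h x)).

End complex_valued.

Definition smooth {R : realType} (g : R -> R) :=
  forall (k : nat) (x : R), derivable (derive1n k g) x 1.

Definition compactly_supported {R : realType} (g : R -> R) :=
  compact (closure [set x | g x != 0]).

(* Main.v *)
From HB Require Import structures.
Require Import Defs.
From mathcomp Require Import all_boot all_order all_algebra.
From mathcomp Require Import all_classical all_reals all_analysis.
From mathcomp Require Import finmap measurable_realfun.
From mathcomp Require Import complex.
From mathcomp Require Import ring lra.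
Set Implicit Arguments.
Unset Strict Implicit.
Unset Printing Implicit Defensive.
Import Order.TTheory GRing.Theory Num.Theory.
Import numFieldNormedType.Exports.
Import HBSimple HBNNSimple.
Local Open Scope classical_set_scope.
Local Open Scope ring_scope.

(* Only the values L_j(phi) = int f_j(x) phi(x_1) dx matter; by Radon-Nikodym
   they are L_j(phi) = int F_j phi for some F_j in L^1(R).  Choose finitely many
   smooth h_m with |h_m| <= 1 whose vectors (L_j(h_m))_j form a basis of the
   space spanned by all L(phi), phi smooth with |phi| <= 1; no linear
   independence of the f_j is then needed.  Look for
     g(t) = chi(t) (k t + sum_m (a_m sin kt + b_m cos kt) h_m(t))
   with chi a smooth cutoff.  To first order in (a, b), averaging over the fast
   oscillation gives L(e^{ig}) = 1/2 sum_m (-a_m + i b_m) L(h_m).  The error is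
   Lipschitz in (a, b) with a constant made small by restricting first to small
   (a, b), then enlarging the region where chi = 1, then taking k large
   (Riemann-Lebesgue).  Hence a fixed-point map is a contraction, and its fixed
   point solves L(e^{ig}) = 0 exactly. *)

(** * Smooth functions and cutoffs *)

(** The unknowns a, b form a 2 x r matrix [l], and the equations a 2 x n matrix [Psi l] with one row
    for each of the phases 0 and pi/2. To first order [Psi l] is [- l *m H], where [H] has the rows
    L(h_m). Freeness of these rows gives [H] a right inverse [P], so that [T l = l + Psi l *m P] has
    no linear term left. A fixed point only yields [Psi l *m P = 0], the vanishing of r combinations
    of the n equations in each row. This is enough because the entries of [Psi l] are twice the
    integrals of cos (g + phase), which is itself smooth and bounded by 1: whatever g turns out to
    be, the rows of [Psi l] lie in the row space of [H], where multiplication by [P] is injective.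
    Hence the h_m must span the values of L on the whole class of such functions before g is known.
    The term k t in g makes [Psi 0] small, and its sine and cosine let the two rows of [l] steer the
    two phases independently. All error bounds are measured against the size of [P], which is fixed
    before rho, M and k. *)

Section smooth_closure.
Context {R : realType}.
Implicit Types (f g : R -> R) (k n : nat) (x : R).

(** Iterated derivatives of products and compositions have no simple closed form. Asking for some
    derivative that is again differentiable k - 1 times turns each closure property into an
    induction on k. *)
Fixpoint smooth_upto k f : Prop :=
  if k is k'.+1 then
    exists2 f', (forall x, is_derive x 1 f (f' x)) & smooth_upto k' f'
  else True.

Lemma smooth_uptoW k f : smooth_upto k.+1 f -> smooth_upto k f.
Proof.
by elim: k f => [//|k IH] f [f' df Hf]; exists f' => //; exact: IH.
Qed.

Lemma smoothP f : smooth f <-> forall k, smooth_upto k f.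
Proof.
split => [fs k|fs k x].
  elim: k f fs => [//|k IH] f fs; exists f^`()%classic.
    by move=> x; rewrite derive1E; apply: derivableP; exact: (fs 0%N x).
  by apply: IH => m x; rewrite -derive1Sn; exact: (fs m.+1 x).
elim: k f fs => [|k IH] f fs; have [f' df fs'] := fs 1%N.
  exact: ex_derive.
rewrite derive1Sn; apply: IH => m; have [g dg gs] := fs m.+1.
rewrite (_ : f^`()%classic = g)//; apply/funext => y.
by rewrite derive1E; exact: derive_val.
Qed.

Lemma smooth_upto_cst k (c : R) : smooth_upto k (fun=> c).
Proof.
elim: k c => [//|k IH] c; exists (fun=> 0); last exact: IH.
by move=> x; exact: is_derive_cst.
Qed.

Lemma smooth_upto_id k : smooth_upto k (fun x => x).
Proof.
case: k => [//|k]; exists (fun=> 1); last exact: smooth_upto_cst.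
by move=> x; exact: is_derive_id.
Qed.

Lemma smooth_uptoD k f g : smooth_upto k f -> smooth_upto k g ->
  smooth_upto k (fun x => f x + g x).
Proof.
elim: k f g => [//|k IH] f g [f' df fs] [g' dg gs].
by exists (fun x => f' x + g' x); [move=> x; exact: is_deriveD|exact: IH].
Qed.

Lemma smooth_uptoM k f g : smooth_upto k f -> smooth_upto k g ->
  smooth_upto k (fun x => f x * g x).
Proof.
elim: k f g => [//|k IH] f g fs gs.
have [f' df fs'] := fs; have [g' dg gs'] := gs.
exists (fun x => f x * g' x + g x * f' x); first by move=> x; exact: is_deriveM.
by apply: smooth_uptoD; apply: IH => //; exact: smooth_uptoW.
Qed.

Lemma smooth_upto_comp k f g : smooth_upto k f -> smooth_upto k g ->
  smooth_upto k (fun x => f (g x)).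
Proof.
elim: k f g => [//|k IH] f g [f' df fs'] gs.
have [g' dg gs'] := gs.
exists (fun x => f' (g x) * g' x); first by move=> x; exact: is_derive1_comp.
by apply: smooth_uptoM => //; apply: IH => //; exact: smooth_uptoW.
Qed.

Lemma smooth_cst (c : R) : smooth (fun=> c : R).
Proof. by apply/smoothP => k; exact: smooth_upto_cst. Qed.

Lemma smooth_id : smooth (fun x : R => x).
Proof. by apply/smoothP => k; exact: smooth_upto_id. Qed.

Lemma smoothD f g : smooth f -> smooth g -> smooth (fun x => f x + g x).
Proof.
by move=> /smoothP fs /smoothP gs; apply/smoothP => k; exact: smooth_uptoD.
Qed.

Lemma smoothM f g : smooth f -> smooth g -> smooth (fun x => f x * g x).
Proof.
by move=> /smoothP fs /smoothP gs; apply/smoothP => k; exact: smooth_uptoM.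
Qed.

Lemma smooth_comp f g : smooth f -> smooth g -> smooth (fun x => f (g x)).
Proof.
by move=> /smoothP fs /smoothP gs; apply/smoothP => k; exact: smooth_upto_comp.
Qed.

Lemma smooth_sum n (F : 'I_n -> R -> R) : (forall i, smooth (F i)) ->
  smooth (fun x => \sum_(i < n) F i x).
Proof.
elim: n F => [|n IH] F Fs.
  by under eq_fun do rewrite big_ord0; exact: smooth_cst.
by under eq_fun do rewrite big_ord_recl; apply: smoothD => //; exact: IH.
Qed.

Lemma smooth_upto_trigo k :
  smooth_upto k (@cos R) /\ smooth_upto k (fun x : R => sin x).
Proof.
elim: k => [//|k [IHc IHs]]; split; last first.
  by exists cos => // x; exact: is_derive_sin.
exists (fun x => - 1 * sin x);
  first by move=> x; rewrite mulN1r; exact: is_derive_cos.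
by apply: smooth_uptoM => //; exact: smooth_upto_cst.
Qed.

Lemma smooth_cos : smooth (@cos R).
Proof. by apply/smoothP => k; have [] := smooth_upto_trigo k. Qed.

Lemma smooth_sin : smooth (@sin R).
Proof. by apply/smoothP => k; have [] := smooth_upto_trigo k. Qed.

Lemma smooth_continuous f : smooth f -> continuous f.
Proof.
move=> fs x; apply: differentiable_continuous; apply/derivable1_diffP.
exact: (fs 0%N x).
Qed.

End smooth_closure.

Section cutoff.
Context {R : realType}.
Implicit Types (n k : nat) (x M : R).

(* x^-n exp(-1/x) for x > 0, continued by 0: this family is stable under
   differentiation up to linear combinations. *)
Definition flat n x : R := if 0 < x then x^-1 ^+ n * expR (- x^-1) else 0.

(** With y = 1/x > 0, the exponential series gives y^(n+1) <= (n+1)! exp y, that is y^n exp(-y) <=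
    (n+1)! / y. The bound serves for continuity at 0. *)
Lemma flat_le n x : `|flat n x| <= n.+1`!%:R * `|x|.
Proof.
rewrite /flat; case: ifPn => [x0|_]; last by rewrite normr0 mulr_ge0.
have y0 : 0 < x^-1 by rewrite invr_gt0.
rewrite !ger0_norm ?mulr_ge0 ?exprn_ge0 ?expR_ge0 ?(ltW y0) ?(ltW x0)//.
rewrite expRN -[X in _ <= _ * X]invrK ler_pdivlMr// mulrAC -exprSr.
rewrite ler_pdivrMr ?expR_gt0//.
have := expR_ge1Dxn n (ltW y0); rewrite -(ler_pM2l (_ : 0 < n.+1`!%:R)).
  apply: le_trans; rewrite mulrDr mulr1 mulrCA mulfV ?mulr1 ?lerDr//.
by rewrite ltr0n fact_gt0.
Qed.

Lemma flatS n x : flat n x = flat n.+1 x * x.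
Proof.
rewrite /flat; case: ifPn => x0; last by rewrite mul0r.
by rewrite mulrAC exprSr -(mulrA _ x^-1) mulVf ?mulr1// gt_eqF.
Qed.

Lemma flat_eq0 n x : x <= 0 -> flat n x = 0.
Proof. by rewrite /flat ltNge => ->. Qed.

Lemma is_derive_flat n x :
  is_derive x 1 (flat n) (- n%:R * flat n.+1 x + flat n.+2 x).
Proof.
have [x0|x0|->] := ltgtP x 0.
- apply: (@near_eq_is_derive _ _ _ (cst 0)).
    by near=> y; rewrite flat_eq0//; apply/ltW; near: y; exact: lt_nbhsl.
  by rewrite !flat_eq0 ?(ltW x0)// mulr0 addr0; exact: is_derive_cst.
- have dV : is_derive x 1 (fun y : R => y^-1) (- x ^- 2 *: 1).
    by apply: is_deriveV; rewrite gt_eqF.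
  have dE := @is_derive1_comp _ _ (fun y => - y^-1) _ _ _
    (is_derive_expR _) (is_deriveN dV).
  have dM := is_deriveM (is_deriveX n dV) dE.
  apply: is_derive_eq; first apply: near_eq_is_derive dM.
    near=> y; rewrite /flat ifT; last by near: y; exact: lt_nbhsr.
    by rewrite !fctE.
  rewrite /flat x0 !fctE /= /GRing.scale /=.
  set E := expR _; rewrite -exprVn !mulr1 opprK.
  case: n {dM} => [|n]; first
    by rewrite !expr0 !mul0r !mulr0 oppr0 !mul0r add0r addr0 mul1r mulrC.
  rewrite /= !exprS; ring.
(* At 0 the difference quotient of [flat n] is exactly [flat n.+1], by [flatS]; its continuity there
   follows from [flat_le]. *)
- apply/is_derive1_caratheodory; exists (flat n.+1).
  split; last by rewrite !flat_eq0 ?lexx// mulr0 addr0.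
    by move=> z; rewrite (@flat_eq0 n 0) ?lexx// !subr0 flatS.
  rewrite /prop_for /continuous_at flat_eq0 ?lexx//; apply/cvgrPdist_le => e e0.
  have c0 : 0 < e / n.+2`!%:R by rewrite divr_gt0// ltr0n fact_gt0.
  apply: filterS (@nbhs0_le R R _ c0) => y yc.
  rewrite sub0r normrN (le_trans (flat_le _ _))//.
  by rewrite mulrC -ler_pdivlMr ?ltr0n ?fact_gt0.
Unshelve. all: by end_near. Qed.

Lemma smooth_flat n : smooth (flat n).
Proof.
apply/smoothP => k; elim: k n => [//|k IH] n.
exists (fun x => - n%:R * flat n.+1 x + flat n.+2 x).
  by move=> x; exact: is_derive_flat.
by apply: smooth_uptoD => //; apply: smooth_uptoM => //; exact: smooth_upto_cst.
Qed.

Lemma flat0_ge0 x : 0 <= flat 0 x.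
Proof. by rewrite /flat; case: ifP => //; rewrite expr0 mul1r expR_ge0. Qed.

Lemma flat0_le x y : x <= y -> flat 0 x <= flat 0 y.
Proof.
move=> xy; rewrite {1}/flat; case: ifPn => [x0|_]; last exact: flat0_ge0.
have y0 := lt_le_trans x0 xy.
by rewrite /flat y0 !expr0 !mul1r ler_expR lerN2 lef_pV2.
Qed.

Lemma exists_smooth_cutoff M : exists chi : R -> R,
  [/\ smooth chi, forall x, 0 <= chi x <= 1,
      forall x, `|x| <= M -> chi x = 1 &
      forall x, M ^+ 2 + 1 <= x ^+ 2 -> chi x = 0].
Proof.
pose a : R := flat 0 1.
have a0 : 0 < a by rewrite /a /flat ltr01 expr0 mul1r expR_gt0.
have fa0 : 0 < flat 0 a by rewrite /flat a0 expr0 mul1r expR_gt0.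
(* A smooth descending step: [st] is 1 on x <= 0, and 0 once [flat 0 x] reaches a = [flat 0 1], that
   is for x >= 1. Composing with x^2 - M^2 avoids the absolute value, which is not smooth. *)
pose st x := (flat 0 a)^-1 * flat 0 (a + - 1 * flat 0 x).
exists (fun x => st (x * x + - M ^+ 2)); split.
- apply: (@smooth_comp _ st); last first.
    apply: smoothD; last exact: smooth_cst.
    by apply: smoothM; exact: smooth_id.
  apply: smoothM; first exact: smooth_cst.

  apply: (smooth_comp (@smooth_flat 0)).
  apply: smoothD; first exact: smooth_cst.
  by apply: smoothM; [exact: smooth_cst|exact: smooth_flat].
- move=> x; rewrite /st mulr_ge0 ?invr_ge0 ?flat0_ge0//=.
  rewrite mulrC ler_pdivrMr// mul1r; apply: flat0_le.
  by rewrite mulN1r gerDl oppr_le0 flat0_ge0.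
- move=> x xM; rewrite /st [X in _ + _ * X](_ : _ = 0).
    by rewrite mulr0 addr0 mulVf// gt_eqF.
  rewrite /flat ifF//; apply/negbTE; rewrite -leNgt subr_le0 -expr2.
  by rewrite -real_normK ?num_real// lerXn2r// ?nnegrE// (le_trans _ xM).
- move=> x xM; rewrite /st [X in _ * X](_ : _ = 0) ?mulr0//.
  rewrite {1}/flat ifF//; apply/negbTE; rewrite -leNgt mulN1r subr_le0.
  by apply: flat0_le; rewrite lerBrDl -expr2.
Qed.

End cutoff.

(** * Integrals of bounded multiples of integrable functions *)

Section bounded_multipliers.
Context d (T : measurableType d) (R : realType).
Variable mu : {measure set T -> \bar R}.
Implicit Types f g h : T -> R.

Lemma integrable_mul_bounded f h (c : R) : mu.-integrable setT (EFin \o f) ->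
  measurable_fun setT h -> (forall x, `|h x| <= c) ->
  mu.-integrable setT (EFin \o (fun x => f x * h x)).
Proof.
move=> fi mh hc.
apply: (@eq_integrable _ _ _ _ _ measurableT ((EFin \o f) \* (EFin \o h))%E) => //.
apply: integrableMl => //; exists c; split; first exact: num_real.
by move=> e ce x _ /=; rewrite (le_trans (hc x))// ltW.
Qed.

Lemma integrable_scale f (c : R) : mu.-integrable setT (EFin \o f) ->
  mu.-integrable setT (EFin \o (fun x => c * f x)).
Proof.
move=> fi; apply: (@eq_integrable _ _ _ _ _ measurableT
  (fun x => c%:E * (EFin \o f) x)%E) => //.
exact: integrableZl.
Qed.

Lemma integrable_add f g : mu.-integrable setT (EFin \o f) ->
  mu.-integrable setT (EFin \o g) ->
  mu.-integrable setT (EFin \o (fun x => f x + g x)).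
Proof.
move=> fi gi; apply: (@eq_integrable _ _ _ _ _ measurableT
  ((EFin \o f) \+ (EFin \o g))%E) => //.
exact: integrableD.
Qed.

Lemma integrable_sub f g : mu.-integrable setT (EFin \o f) ->
  mu.-integrable setT (EFin \o g) ->
  mu.-integrable setT (EFin \o (fun x => f x - g x)).
Proof.
move=> fi gi; apply: (@eq_integrable _ _ _ _ _ measurableT
  ((EFin \o f) \- (EFin \o g))%E) => //.
exact: integrableB.
Qed.

Lemma normr_Rintegral_mul_le f h (c : R) : mu.-integrable setT (EFin \o f) ->
  measurable_fun setT h -> (forall x, `|h x| <= c) ->
  `|\int[mu]_x (f x * h x)| <= c * \int[mu]_x `|f x|.
Proof.
move=> fi mh hc; have fhi := integrable_mul_bounded fi mh hc.
apply: le_trans (le_normr_Rintegral measurableT fhi) _.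
have nfi : mu.-integrable setT (EFin \o (fun x => `|f x|)).
  exact: integrable_norm.
rewrite -RintegralZl//; apply: le_Rintegral => //.
- exact: (integrable_norm fhi).
- exact: integrable_scale.
- by move=> x _; rewrite normrM mulrC ler_wpM2r.
Qed.

Lemma integrable_sumr n (F : 'I_n -> T -> R) :
  (forall i, mu.-integrable setT (EFin \o F i)) ->
  mu.-integrable setT (EFin \o (fun x => \sum_(i < n) F i x)).
Proof.
move=> Fi; apply: (@eq_integrable _ _ _ _ _ measurableT
  (fun x => \sum_(i < n) (EFin \o F i) x)%E).
  by move=> x _; rewrite /= sumEFin.
by apply: integrable_sum => //= i _; exact: Fi.
Qed.

Lemma Rintegral_sum n (F : 'I_n -> T -> R) :
  (forall i, mu.-integrable setT (EFin \o F i)) ->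
  \int[mu]_x (\sum_(i < n) F i x) = \sum_(i < n) \int[mu]_x F i x.
Proof.
move=> Fi.
elim: n F Fi => [|n IH] F Fi.
  rewrite big_ord0; under eq_Rintegral do rewrite big_ord0.
  by rewrite /Rintegral integral0.
rewrite big_ord_recl -IH//; under eq_Rintegral do rewrite big_ord_recl.
by rewrite RintegralD//; exact: integrable_sumr.
Qed.

Lemma Rdominated_convergence_L1 (f_ : nat -> T -> R) f g :
  (forall n, measurable_fun setT (f_ n)) -> measurable_fun setT f ->
  (forall x, f_ ^~ x @ \oo --> f x) -> mu.-integrable setT (EFin \o g) ->
  (forall n x, `|f_ n x| <= g x) ->
  (fun n => \int[mu]_x `|f x - f_ n x|) @ \oo --> (0 : R).
Proof.
move=> mf_ mf f_f gi f_g.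
have [||||| _ + _] := @dominated_convergence _ _ _ mu setT measurableT
  (fun n => EFin \o f_ n) (EFin \o f) (EFin \o g).
- by move=> n; exact/measurable_EFinP.
- exact/measurable_EFinP.
- by apply: aeW => x _; apply: cvg_EFin; [exact: nearW|exact: f_f].
- exact: gi.
- by apply: aeW => x n _ /=; rewrite lee_fin.
move/fine_cvg; set s := (fine \o _) => s0.
rewrite (_ : (fun n => _) = s)//; apply/funext => n.
by congr fine; apply: eq_integral => x _; rewrite /= distrC.
Qed.

Lemma Rdominated_convergence (f_ : nat -> T -> R) f g :
  (forall n, measurable_fun setT (f_ n)) -> measurable_fun setT f ->
  (forall x, f_ ^~ x @ \oo --> f x) -> mu.-integrable setT (EFin \o g) ->
  (forall n x, `|f_ n x| <= g x) ->
  (fun n => \int[mu]_x f_ n x) @ \oo --> \int[mu]_x f x.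
Proof.
move=> mf_ mf f_f gi f_g.
have [||||| fi _ +] := @dominated_convergence _ _ _ mu setT measurableT
  (fun n => EFin \o f_ n) (EFin \o f) (EFin \o g).
- by move=> n; exact/measurable_EFinP.
- exact/measurable_EFinP.
- by apply: aeW => x _; apply: cvg_EFin; [exact: nearW|exact: f_f].
- exact: gi.
- by apply: aeW => x n _ /=; rewrite lee_fin.
rewrite -[X in _ --> X]fineK; first exact: fine_cvg.
exact: integrable_fin_num fi.
Qed.

Lemma Rintegral_cvg0_le (v_ : nat -> R) (e : R) : 0 < e ->
  v_ @ \oo --> (0 : R) -> (forall n, 0 <= v_ n) -> exists n, v_ n <= e.
Proof.
move=> e0 /cvgrPdist_le/(_ _ e0)[n _ /(_ n (leqnn n))] vn v0.
by exists n; move: vn; rewrite sub0r normrN /= ger0_norm.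
Qed.

End bounded_multipliers.

(** The truncations of F converge to F in L^1 by dominated convergence, each point being eventually
    inside the interval. The interval is half-open to match the generators of the Borel sets used
    for the Riemann-Lebesgue lemma. *)
Lemma exists_L1_tail_le (R : realType) (F : R -> R) (e : R) : 0 < e ->
  (@lebesgue_measure R).-integrable setT (EFin \o F) ->
  exists2 M : R, 0 < M &
  \int[@lebesgue_measure R]_t `|F t - F t * \1_`]- M, M] t| <= e.
Proof.
move=> e0 Fi.
have mF : measurable_fun [set: measurableTypeR R] F.
  by apply/measurable_EFinP; exact: measurable_int Fi.
have mI n : measurable_fun [set: measurableTypeR R]
    (fun t => F t * \1_`]- n.+1%:R, n.+1%:R] t : R).
  by apply: measurable_funM => //; exact: measurable_indic.
have [n nF] : exists n : nat,
    \int[@lebesgue_measure R]_t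
      `|F t - F t * \1_`]- n.+1%:R, n.+1%:R] t| <= e.
  apply: Rintegral_cvg0_le => //; last first.
    by move=> n; apply: Rintegral_ge0.
  have H := @Rdominated_convergence_L1 _ (measurableTypeR R) R
    (@lebesgue_measure R)
    (fun n t => F t * \1_`]- n.+1%:R, n.+1%:R] t) F (fun t => `|F t|) mI mF.
  apply: H.
    move=> t; apply: cvg_near_cst; near=> n.
    rewrite indicE mem_set ?mulr1//= in_itv/=.
    suff : `|t| < n.+1%:R by rewrite ltr_norml => /andP[-> /ltW].
    rewrite (@le_lt_trans _ _ n%:R) ?ltr_nat//; near: n.
    exact: nbhs_infty_ger.
    exact: integrable_norm.
  move=> n t; rewrite normrM indicE.
  by case: (_ \in _); rewrite ?normr1 ?mulr1// normr0 mulr0.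
by exists n.+1%:R.
Unshelve. all: by end_near. Qed.

(** * Marginal densities *)

Section marginal_density.
Context d (T : measurableType d) (R : realType).
Variables (mu : {measure set T -> \bar R}) (p : T -> measurableTypeR R).
Hypothesis mp : measurable_fun setT p.
Hypothesis mu_null : forall A : set (measurableTypeR R), measurable A ->
  lebesgue_measure A = 0%E -> mu (p @^-1` A) = 0%E.
Local Notation lam := (@lebesgue_measure R).

Let mpre (A : set (measurableTypeR R)) : measurable A -> measurable (p @^-1` A).
Proof. by move=> mA; rewrite -[X in measurable X]setTI; exact: mp. Qed.

(** F is the Radon-Nikodym derivative of the image under p of the finite signed measure f mu. The
    image of mu itself would not do: for a projection of R^N with N >= 2 it is infinite on every set
    of positive measure. *)
Lemma marginal_density_set (f : T -> R) : mu.-integrable setT (EFin \o f) ->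
  exists2 F : measurableTypeR R -> R, lam.-integrable setT (EFin \o F) &
    forall A, measurable A ->
      \int[mu]_(x in p @^-1` A) f x = \int[lam]_(t in A) F t.
Proof.
move=> fi.
pose nu0 : {charge set T -> \bar R} := induced_charge fi.
pose nu : {charge set (measurableTypeR R) -> \bar R} :=
  measure_function_pushforward__canonical__charge_Charge nu0 mp.
have nu_lam : nu `<< lam.
  apply/null_content_dominatesP => A mA A0.
  apply: null_set_integral; [exact: mpre| |exact: mu_null].
  by apply: measurable_funTS; exact: measurable_int fi.
have Fi := Radon_Nikodym_integrable nu_lam.
have Ffin t := Radon_Nikodym_fin_num t nu_lam.
have FE : EFin \o (fine \o Radon_Nikodym nu lam) = Radon_Nikodym nu lam.
  by apply/funext => t /=; rewrite fineK.
exists (fine \o Radon_Nikodym nu lam); first by rewrite FE.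
move=> A mA; rewrite /Rintegral -[in RHS]/(EFin \o _) [RHS](_ : _ = fine (nu A)) //.
congr fine; rewrite (Radon_Nikodym_integral nu_lam mA).
by apply: eq_integral => t _; rewrite fineK.
Qed.

Section bounded_test_functions.
Variables (f : T -> R) (F : measurableTypeR R -> R).
Hypothesis fi : mu.-integrable setT (EFin \o f).
Hypothesis Fi : lam.-integrable setT (EFin \o F).
Hypothesis fF : forall A, measurable A ->
  \int[mu]_(x in p @^-1` A) f x = \int[lam]_(t in A) F t.

Let mfp (h : measurableTypeR R -> R) :
  measurable_fun setT h -> measurable_fun setT (h \o p).
Proof. by move=> mh; exact: measurableT_comp. Qed.

Let indic_case (A : set (measurableTypeR R)) : measurable A ->
  \int[mu]_x (f x * \1_A (p x)) = \int[lam]_t (F t * \1_A t).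
Proof.
move=> mA; transitivity (\int[mu]_(x in p @^-1` A) f x).
  rewrite [RHS]Rintegral_mkcond; apply: eq_Rintegral => x _.
  rewrite patchE indicE.
  have -> : (x \in p @^-1` A) = (p x \in A) by apply/idP/idP => /set_mem H; apply/mem_set.
  by case: ifP; rewrite ?mulr1 ?mulr0.
rewrite fF// Rintegral_mkcond; apply: eq_Rintegral => x _.
by rewrite patchE indicE; case: ifP; rewrite ?mulr1 ?mulr0.
Qed.

Let simple_case (s : {sfun measurableTypeR R >-> R}) :
  \int[mu]_x (f x * s (p x)) = \int[lam]_t (F t * s t).
Proof.
pose c := fset_set (s @` setT).
have mc i : measurable (s @^-1` [set c`_i]).
  by apply: measurable_funPTI; exact: measurable_set1.
transitivity (\int[mu]_x
    \sum_(i < #|` c|) c`_i * (f x * \1_(s @^-1` [set c`_i]) (p x))).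
  apply: eq_Rintegral => x _; rewrite fimfunEord mulr_sumr.
  by apply: eq_bigr => i _; rewrite mulrCA.
transitivity (\int[lam]_t
    \sum_(i < #|` c|) c`_i * (F t * \1_(s @^-1` [set c`_i]) t)); last first.
  apply: eq_Rintegral => x _; rewrite fimfunEord mulr_sumr.
  by apply: eq_bigr => i _; rewrite mulrCA.
have i1 (i : nat) : mu.-integrable setT
    (EFin \o (fun x => f x * \1_(s @^-1` [set c`_i]) (p x))).
  apply: (@integrable_mul_bounded _ _ _ _ _ _ 1) => //.
    by apply: (mfp (h := \1__)); exact: measurable_indic.
  by move=> t; rewrite indicE; case: (_ \in _); rewrite ?normr1// normr0.
have i2 (i : nat) : lam.-integrable setT
    (EFin \o (fun x => F x * \1_(s @^-1` [set c`_i]) x)).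
  apply: (@integrable_mul_bounded _ _ _ _ _ _ 1) => //.
  by move=> t; rewrite indicE; case: (_ \in _); rewrite ?normr1// normr0.
rewrite !Rintegral_sum; last 2 first.
  by move=> i; exact: integrable_scale.
  by move=> i; exact: integrable_scale.
by apply: eq_bigr => i _; rewrite !RintegralZl// indic_case.
Qed.

(** Simple functions increasing to h stay below c, so c |f| and c |F| dominate the two sides and the
    identity for simple functions passes to the limit. *)
Let nonneg_case (h : measurableTypeR R -> R) (c : R) : measurable_fun setT h ->
  (forall t, 0 <= h t <= c) ->
  \int[mu]_x (f x * h (p x)) = \int[lam]_t (F t * h t).
Proof.
move=> mh hc.
have meh : measurable_fun [set: measurableTypeR R] (EFin \o h).
  exact/measurable_EFinP.
pose s := nnsfun_approx measurableT meh.
have h0 t : [set: measurableTypeR R] t -> (0 <= (EFin \o h) t)%E.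
  by move=> _; rewrite lee_fin; have /andP[] := hc t.
have sh t : (fun n => s n t) @ \oo --> h t.
  by have /fine_cvg := cvg_nnsfun_approx measurableT meh h0 (x := t) I.
have sc n t : `|s n t| <= c.
  rewrite ger0_norm// -lee_fin.
  have := le_approx n h0 (x := t) I; rewrite -nnsfun_approxE => /le_trans; apply.
  by rewrite lee_fin; have /andP[] := hc t.
have mf : measurable_fun setT f.
  by apply/measurable_EFinP; exact: measurable_int fi.
have mF : measurable_fun [set: measurableTypeR R] F.
  by apply/measurable_EFinP; exact: measurable_int Fi.
have L1 : (fun n => \int[mu]_x (f x * s n (p x))) @ \oo -->
    \int[mu]_x (f x * h (p x)).
  apply: (@Rdominated_convergence _ _ _ _ _ _ (fun x => c * `|f x|)).
  - by move=> n; apply: measurable_funM => //; apply: mfp.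
  - by apply: measurable_funM => //; apply: mfp.
  - by move=> x; apply: cvgMr; exact: sh.
  - by apply: integrable_scale; exact: integrable_norm.
  - by move=> n x; rewrite normrM mulrC ler_wpM2r.
have L2 : (fun n => \int[lam]_t (F t * s n t)) @ \oo -->
    \int[lam]_t (F t * h t).
  apply: (@Rdominated_convergence _ _ _ _ _ _ (fun x => c * `|F x|)).
  - by move=> n; apply: measurable_funM.
  - by apply: measurable_funM.
  - by move=> x; apply: cvgMr; exact: sh.
  - by apply: integrable_scale; exact: integrable_norm.
  - by move=> n x; rewrite normrM mulrC ler_wpM2r.
move: L1; rewrite (_ : (fun n => _) = fun n => \int[lam]_t (F t * s n t)).
  by move=> L1; exact: cvg_unique L1 L2.
apply/funext => n; exact: simple_case.
Qed.

Lemma marginal_density_test (h : measurableTypeR R -> R) (c : R) :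
  measurable_fun setT h -> (forall t, `|h t| <= c) ->
  \int[mu]_x (f x * h (p x)) = \int[lam]_t (F t * h t).
Proof.
move=> mh hc.
have fhi : mu.-integrable setT (EFin \o (fun x => f x * h (p x))).
  by apply: (@integrable_mul_bounded _ _ _ _ _ (h \o p) c) => [||t] /=;
    [exact: fi|exact: mfp|exact: hc].
have Fhi : lam.-integrable setT (EFin \o (fun x => F x * h x)).
  exact: (@integrable_mul_bounded _ _ _ _ _ h c).
(* Shifting by c makes h nonnegative without a splitting into positive and negative parts; the added
   constant is removed again by the case A = R of [fF]. *)
have H1 : \int[mu]_x (f x * (h (p x) + c)) = \int[lam]_t (F t * (h t + c)).
  apply: (nonneg_case (h := fun t => h t + c) (c := c + c)).
    exact: measurable_funD.
  move=> t; have := hc t; rewrite ler_norml => /andP[h1 h2].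
  by rewrite -lerBlDr sub0r h1 lerD2r.
have H2 : \int[mu]_x (c * f x) = \int[lam]_t (c * F t).
  by rewrite !RintegralZl//; have := fF measurableT; rewrite preimage_setT => ->.
have -> : (fun x => f x * h (p x)) =
    (fun x => f x * (h (p x) + c) - c * f x) by apply/funext => x; ring.
have -> : (fun x => F x * h x) =
    (fun x => F x * (h x + c) - c * F x) by apply/funext => x; ring.
rewrite !RintegralB ?H1 ?H2//.
all: try exact: integrable_scale.
- rewrite (_ : (fun t => _) = fun t => F t * h t + c * F t).
    by apply: integrable_add => //; exact: integrable_scale.
  by apply/funext => t; ring.
- rewrite (_ : (fun t => _) = fun t => f t * h (p t) + c * f t).
    by apply: integrable_add => //; exact: integrable_scale.
  by apply/funext => t; ring.
Qed.

End bounded_test_functions.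
End marginal_density.

Lemma lebesgueN_marginal (R : realType) N (i : 'I_N) (f : N.-tuple R -> R) :
  (lebesgueN N).-integrable setT (EFin \o f) ->
  exists2 F : measurableTypeR R -> R,
    (@lebesgue_measure R).-integrable setT (EFin \o F) &
    forall (h : measurableTypeR R -> R) (c : R), measurable_fun setT h ->
      (forall t, `|h t| <= c) ->
      \int[lebesgueN N]_x (f x * h (tnth x i)) =
      \int[@lebesgue_measure R]_t (F t * h t).
Proof.
move=> fi.
pose p (x : caratheodory_type ((lebesgue_tuple (R := R) N)^*)%mu) :
  measurableTypeR R := tnth (x : N.-tuple (measurableTypeR R)) i.
have mp : measurable_fun setT p.
  move=> _ A mA; rewrite setTI; apply: sub_caratheodory.
  apply: sub_sigma_algebra.
  have := @measurable_tnth _ (measurableTypeR R) N i measurableT A mA.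
  by rewrite setTI.
have null A : measurable A -> (@lebesgue_measure R) A = 0%E ->
    lebesgueN N (p @^-1` A) = 0%E.
  move=> mA A0.
  (* The preimage of A is a box whose other sides are all of R; its measure is a product with a
     factor 0, and 0 times infinity is 0. *)
  pose B (j : 'I_N) : set (measurableTypeR R) := if j == i then A else setT.
  rewrite (_ : p @^-1` A = [set t | forall j, B j (tnth t j)]).
    rewrite lebesgueN_box; last by move=> j; rewrite /B; case: ifP.
    by rewrite (bigD1 i)//= {1}/B eqxx A0 mul0e.
  apply/seteqP; split => t; rewrite /p /B /=.
    by move=> At j; case: eqP => // ->.
  by move=> /(_ i); rewrite eqxx.
have [F Fi fF] := marginal_density_set mp null fi.
exists F => // h c mh hc.
exact: (marginal_density_test mp fi Fi fF mh hc).
Qed.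

(** * The Riemann-Lebesgue lemma *)

Section riemann_lebesgue.
Context (R : realType).
Local Notation mu := (@lebesgue_measure R).
Variables (u U : R -> R).
Hypothesis cu : continuous u.
Hypothesis u1 : forall x, `|u x| <= 1.
Hypothesis dU : forall x : R, is_derive x 1 U (u x).
Hypothesis U1 : forall x, `|U x| <= 1.
Implicit Types F G : R -> R.

Let mosc (k : nat) : measurable_fun [set: R] (fun t => u (k%:R * t)).
Proof.
apply: continuous_measurable_fun => x.
by apply: continuous_comp; [exact: mulrl_continuous|exact: cu].
Qed.

Let iosc F (k : nat) : mu.-integrable setT (EFin \o F) ->
  mu.-integrable setT (EFin \o (fun t => F t * u (k%:R * t))).
Proof. by move=> Fi; apply: (integrable_mul_bounded Fi (mosc k)) => x. Qed.

(** The oscillation [u] is any continuous function bounded by 1 with a primitive [U] bounded by 1,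
    so that cosine and sine are both instances. *)
Definition vanishing F :=
  (fun k : nat => \int[mu]_t (F t * u (k%:R * t))) @ \oo --> (0 : R).

Lemma vanishingD F G : mu.-integrable setT (EFin \o F) ->
  mu.-integrable setT (EFin \o G) ->
  vanishing F -> vanishing G -> vanishing (fun t => F t + G t).
Proof.
move=> Fi Gi vF vG; rewrite /vanishing (_ : (fun k : nat => _) =
  (fun k : nat => \int[mu]_t (F t * u (k%:R * t))) \+
  (fun k : nat => \int[mu]_t (G t * u (k%:R * t)))).
  by rewrite -[0]addr0; exact: cvgD.
apply/funext => k /=; under eq_Rintegral do rewrite mulrDl.
by rewrite RintegralD//; exact: iosc.
Qed.

Lemma vanishingZ F (c : R) : mu.-integrable setT (EFin \o F) ->
  vanishing F -> vanishing (fun t => c * F t).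
Proof.
move=> Fi vF; rewrite /vanishing (_ : (fun k : nat => _) =
  (fun k : nat => c * \int[mu]_t (F t * u (k%:R * t)))).
  by rewrite -[0](mulr0 c); exact: cvgMr.
apply/funext => k /=; under eq_Rintegral do rewrite -mulrA.
by rewrite RintegralZl//; exact: iosc.
Qed.

(** Since |u| <= 1, replacing F by G changes every oscillating integral by at most the L^1 distance,
    uniformly in k: the property is closed in L^1. *)
Lemma vanishing_approx F : mu.-integrable setT (EFin \o F) ->
  (forall e, 0 < e -> exists G, [/\ mu.-integrable setT (EFin \o G),
    vanishing G & \int[mu]_t `|F t - G t| <= e]) -> vanishing F.
Proof.
move=> Fi H; apply/cvgrPdist_le => e e0.
have [G [Gi vG FG]] := H _ (divr_gt0 e0 (ltr0n _ 2)).
move/cvgrPdist_le : vG => /(_ _ (divr_gt0 e0 (ltr0n _ 2))).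
apply: filterS => k; rewrite !sub0r !normrN => Gk.
have FGi : mu.-integrable setT (EFin \o (fun t => F t - G t)).
  exact: integrable_sub.
rewrite (_ : (fun t => _) = (fun t => (F t - G t) * u (k%:R * t) +
  G t * u (k%:R * t))); last by apply/funext => t; ring.
rewrite RintegralD//; [|exact: iosc|exact: iosc].
rewrite (le_trans (ler_normD _ _))// [leRHS]splitr lerD//.
rewrite (le_trans _ FG)// -[leRHS]mul1r.
exact: (normr_Rintegral_mul_le FGi (mosc k)).
Qed.

(** The function U (k t) / k is a primitive of u (k t), so the integral over the interval is at most
    2 / k. *)
Lemma vanishing_itv (a b : R) : vanishing \1_`]a, b].
Proof.
have [ab|ba] := ltP a b; last first.
  rewrite set_itv_ge ?bnd_simp -?leNgt// /vanishing.
  under eq_fun do under eq_Rintegral do rewrite indic0 mul0r.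
  by rewrite /Rintegral integral0; exact: cvg_cst.
suff H (k : nat) : (0 < k)%N ->
    `|\int[mu]_t (\1_`]a, b] t * u (k%:R * t))| <= 2 * k%:R^-1.
  apply/cvgrPdist_le => e e0; near=> k.
  rewrite sub0r normrN (le_trans (H k _))//; first by near: k; exists 1%N.
  rewrite ler_pdivrMr ?ltr0n; last by near: k; exists 1%N.
  rewrite mulrC -ler_pdivrMr//; near: k; exact: nbhs_infty_ger.
move=> k0; have kR : (0 : R) < k%:R by rewrite ltr0n.
rewrite (_ : Rintegral _ _ _ = k%:R^-1 * (U (k%:R * b) - U (k%:R * a))).
  have kV : (0 : R) < k%:R^-1 by rewrite invr_gt0.
  rewrite normrM (gtr0_norm kV) [leRHS]mulrC (ler_pM2l kV).
  by rewrite (le_trans (ler_normB _ _))// lerD.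
have cont : continuous (fun t : R => u (k%:R * t)).
  by move=> x; apply: continuous_comp; [exact: mulrl_continuous|exact: cu].
have dF (x : R) : is_derive x 1 (fun t : R => k%:R^-1 * U (k%:R * t)) (u (k%:R * x)).
  have d1 : is_derive x 1 (fun t : R => k%:R * t) k%:R.
    apply: is_derive_eq (is_deriveM (is_derive_cst _ _ _) (is_derive_id _ _)) _.
    by rewrite /GRing.scale/= mulr0 addr0 mulr1.
  have d2 := @is_derive1_comp _ U (fun t => k%:R * t) _ _ _ (dU _) d1.
  apply: is_derive_eq (is_deriveM (is_derive_cst _ _ _) d2) _.
  by rewrite /GRing.scale/= mulr0 addr0 mulrCA mulVf ?mulr1// gt_eqF.
transitivity (\int[mu]_(t in `]a, b]) u (k%:R * t)).
  rewrite [RHS]Rintegral_mkcond; apply: eq_Rintegral => t _.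
  by rewrite patchE indicE; case: ifP; rewrite ?mul1r ?mul0r.
rewrite Rintegral_itv_obnd_cbnd; last first.
  apply: (@integrableS _ _ _ mu `[a, b]) => //; first exact: subset_itv_oc_cc.
  apply: continuous_compact_integrable; first exact: segment_compact.
  exact: continuous_subspaceT.
rewrite /Rintegral (@continuous_FTC2 _ _ (fun t => k%:R^-1 * U (k%:R * t)))//=.
- by rewrite mulrBr.
- exact: continuous_subspaceT.
- have cF : continuous (fun t : R => k%:R^-1 * U (k%:R * t)).
    move=> x; apply: differentiable_continuous; apply/derivable1_diffP.
    exact: ex_derive.
  split; first by move=> x _; exact: ex_derive.
    by apply: cvg_at_right_filter; exact: cF.
  by apply: cvg_at_left_filter; exact: cF.
- by move=> x _; rewrite derive1E; exact: derive_val.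
Unshelve. all: by end_near. Qed.

Lemma normr_indic_le1 (A : set (measurableTypeR R)) t : `|\1_A t : R| <= 1.
Proof. by rewrite indicE; case: (_ \in _); rewrite ?normr1// normr0. Qed.

Lemma integrable_indic_bounded (M : R) (A : set (measurableTypeR R)) :
  measurable A -> mu.-integrable setT (EFin \o \1_(A `&` `]- M, M])).
Proof.
move=> mA; rewrite setIC indicI.
apply: (@integrable_mul_bounded _ (measurableTypeR R) _ _ _ _ 1).
- exact: integrable_indic_itv.
- exact: measurable_indic.
- by move=> t; exact: normr_indic_le1.
Qed.

(** Dynkin's pi-lambda argument: half-open intervals are stable under intersection and generate the
    Borel sets, and the sets A with this property form a lambda-system. Intersecting with a bounded
    interval keeps all indicators integrable, including those of complements; countable disjoint
    unions pass by L^1 closedness. *)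
Lemma vanishing_indic (M : R) (A : set (measurableTypeR R)) :
  measurable A -> vanishing \1_(A `&` `]- M, M]).
Proof.
set B := `]- M, M]%classic.
pose P (A : set (measurableTypeR R)) := vanishing \1_(A `&` B).
move=> mA; rewrite -/(P A).
have mB : measurable (B : set (measurableTypeR R)) by exact: measurable_itv.
apply: (@dynkin_induction _ (measurableTypeR R) (@ocitv R)) mA => //.
- exact: ocitvI.
- by rewrite /P setTI; exact: vanishing_itv.
- move=> S oS; rewrite /P.
  have /ocitvP[->|[[a b] /= _ ->]] : ocitv (S `&` B) by apply: ocitvI => //; exact: is_ocitv.
    by rewrite -(set_itvoc0 (0 : R)); exact: vanishing_itv.
  exact: vanishing_itv.
- move=> S mS PS; rewrite /P (_ : \1_(~` S `&` B) =
    fun t => \1_(setT `&` B) t + -1 * \1_(S `&` B) t); last first.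
    apply/funext => t; rewrite setTI !indicE !in_setI in_setC.
    by case: (t \in S); case: (t \in B) => /=; rewrite ?mulN1r ?subrr ?subr0 ?mulr0 ?addr0.
  apply: vanishingD.
  + exact: integrable_indic_bounded.
  + by apply: integrable_scale; exact: integrable_indic_bounded.
  + by rewrite setTI; exact: vanishing_itv.
  + by apply: vanishingZ => //; exact: integrable_indic_bounded.
- move=> F mF tF PF.
  pose S n := \big[setU/set0]_(i < n) F i.
  have mS n : measurable (S n) by apply: bigsetU_measurable.
  have PS n : P (S n).
    elim: n => [|n IH].
      rewrite /P /S big_ord0 set0I -(set_itvoc0 (0 : R)); exact: vanishing_itv.
    rewrite /P (_ : \1_(S n.+1 `&` B) =
      fun t => \1_(S n `&` B) t + \1_(F n `&` B) t); last first.
      apply/funext => t; rewrite /S big_ord_recr/= -/(S n).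
      have SF : ~ ((t \in S n) && (t \in F n)).
        have tF' : trivIset (fun x : nat => predT x) F.
          by move=> i j _ _; exact: tF.
        by rewrite -in_setI (trivIset_bigsetUI tF') ?in_set0.
      move: SF; rewrite !indicE !in_setI in_setU.
      by case: (t \in S n); case: (t \in F n); case: (t \in B) => //= _;
        rewrite ?addr0 ?add0r.
    apply: vanishingD; [| |exact: IH|exact: PF];
      by apply: integrable_indic_bounded.
  have iU : mu.-integrable setT (EFin \o \1_(\bigcup_k F k `&` B)).
    by apply: integrable_indic_bounded; exact: bigcup_measurable.
  apply: vanishing_approx iU _ => e e0.
  have [n nS] : exists n : nat,
      \int[mu]_t `|\1_(\bigcup_k F k `&` B) t - \1_(S n `&` B) t| <= e.
    apply: Rintegral_cvg0_le => //; last by move=> n; exact: Rintegral_ge0.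
    have H := @Rdominated_convergence_L1 _ (measurableTypeR R) R mu
      (fun n => \1_(S n `&` B)) \1_(\bigcup_k F k `&` B) \1_B.
    apply: H.
    - by move=> n; apply: measurable_indic; exact: measurableI.
    - by apply: measurable_indic; apply: measurableI => //; exact: bigcup_measurable.
    - move=> t; apply: cvg_near_cst.
      have [[m _ Fmt]|Ft] := pselect ((\bigcup_k F k) t).
        exists m.+1 => // n /= mn; rewrite !indicE !in_setI.
        rewrite (mem_set (_ : S n t)); last first.
          by rewrite /S -bigcup_mkord; exists m.
        by rewrite (mem_set (_ : (\bigcup_k F k) t))//; exists m.
      apply: nearW => n; rewrite !indicE !in_setI (memNset Ft).
      rewrite (memNset (_ : ~ S n t))// /S -bigcup_mkord => -[m _ Fmt].
      by apply: Ft; exists m.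
    - exact: integrable_indic_itv.
    - move=> n t; rewrite !indicE in_setI.
      by case: (_ \in S n); case: (_ \in B); rewrite ?normr1 ?normr0.
  exists \1_(S n `&` B); split => //; first exact: integrable_indic_bounded.
  exact: PS.
Qed.

Lemma vanishing_sum n (G : 'I_n -> R -> R) :
  (forall i, mu.-integrable setT (EFin \o G i)) ->
  (forall i, vanishing (G i)) -> vanishing (fun t => \sum_(i < n) G i t).
Proof.
elim: n G => [|n IH] G Gi vG.
  under eq_fun do rewrite big_ord0.
  have := @vanishingZ \1_`]0, 0] 0 (integrable_indic_itv _ _ _ _) (vanishing_itv _ _).
  by under eq_fun do rewrite mul0r.
under eq_fun do rewrite big_ord_recl.
apply: vanishingD => //; last by apply: IH.
exact: (@integrable_sumr _ (measurableTypeR R)).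
Qed.

Lemma vanishing_simple (M : R) (s : {sfun (measurableTypeR R) >-> R}) :
  mu.-integrable setT (EFin \o (fun t => s t * \1_`]- M, M] t)) /\
  vanishing (fun t => s t * \1_`]- M, M] t).
Proof.
pose c := fset_set (s @` setT).
have -> : (fun t => s t * \1_`]- M, M] t) = (fun t : measurableTypeR R =>
    \sum_(i < #|` c|) c`_i * \1_(s @^-1` [set c`_i] `&` `]- M, M]) t).
  apply/funext => t; rewrite fimfunEord mulr_suml; apply: eq_bigr => i _.
  by rewrite indicI mulrA.
have mc i : measurable (s @^-1` [set c`_i]).
  by apply: measurable_funPTI; exact: measurable_set1.
have ic i := integrable_scale c`_i (integrable_indic_bounded M (mc i)).
split; first exact: (@integrable_sumr _ (measurableTypeR R)).
apply: vanishing_sum => // i; apply: vanishingZ.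
  exact: integrable_indic_bounded.
exact: vanishing_indic.
Qed.

Lemma riemann_lebesgue F : mu.-integrable setT (EFin \o F) -> vanishing F.
Proof.
move=> Fi; apply: (vanishing_approx Fi) => e e0.
have [M M0 FM] := exists_L1_tail_le e0 Fi.
have FBi : mu.-integrable setT (EFin \o (fun t => F t * \1_`]- M, M] t)).
  apply: (@integrable_mul_bounded _ (measurableTypeR R) _ _ _ _ 1) => //.
  by move=> t; exact: normr_indic_le1.
exists (fun t => F t * \1_`]- M, M] t); split => //.
(* A second approximation, now of the truncated function by truncated simple functions, which are
   integrable because the interval is bounded. *)
apply: (vanishing_approx FBi) => {e0 FM}e e0.
have FB : mu.-integrable `]- M, M] (EFin \o F) by apply: integrableS Fi.
have mB : measurable (`]- M, M]%classic : set (measurableTypeR R)).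
  exact: measurable_itv.
have [s [si _ sF]] := approximation_sfun_integrable mB FB.
have [n sn] : exists n, \int[mu]_(t in `]- M, M]) `|F t - s n t| <= e.
  apply: Rintegral_cvg0_le => //; last by move=> n; exact: Rintegral_ge0.
  exact: fine_cvg sF.
have [Gi vG] := vanishing_simple M (s n).
exists (fun t => s n t * \1_`]- M, M] t); split => //.
apply: le_trans sn; rewrite [leRHS]Rintegral_mkcond.
rewrite le_eqVlt; apply/orP; left; apply/eqP; apply: eq_Rintegral => t _.
rewrite patchE -mulrBl indicE normrM.
by case: ifP; rewrite ?normr1 ?mulr1// normr0 mulr0.
Qed.

End riemann_lebesgue.

(** * Spanning families and contractions of matrices *)

(** Among finite families in D take one whose matrix has the largest rank, which is at most n, and
    keep a maximal free set of its rows. Any value outside their span could be adjoined to raise the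
    rank. *)
Lemma exists_spanning_free_family (K : fieldType) n (X : Type) (D : X -> Prop)
    (L : X -> 'rV[K]_n) :
  exists r (h : 'I_r -> X), [/\ forall m, D (h m),
    row_free (\matrix_m L (h m)) &
    forall x, D x -> (L x <= \matrix_m L (h m))%MS].
Proof.
pose P d := `[< exists r (h : 'I_r -> X), (forall m, D (h m)) /\
  \rank (\matrix_m L (h m)) = d >].
have P0 : exists d, P d.
  exists 0%N; apply/asboolP; exists 0%N,
    (* The empty family, since D may have no member. *)
    (fun i : 'I_0 => match i with Ordinal m Hm => False_rect X (notF Hm) end).
  by split => [[]//|]; apply/eqP; rewrite -leqn0 rank_leq_row.
have Pn d : P d -> (d <= n)%N.
  by move=> /asboolP[r [h [_ <-]]]; exact: rank_leq_col.
have [d /asboolP[r [h [Dh hd]]] dmax] := ex_maxnP P0 Pn.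
set A := \matrix_m L (h m) in hd.
pose h' m := h (maxrankfun A m).
have A'E : \matrix_m L (h' m) = rowsub (maxrankfun A) A.
  by apply/matrixP => i j; rewrite !mxE.
exists (\rank A), h'; rewrite A'E; split; [by move=> m; exact: Dh| |].
  exact: maxrowsub_free.
move=> x Dx; pose hx i := oapp h' x (unlift ord0 i).
(* [A2] is the free family with x adjoined at index 0. It contains the row space of [A'] and by
   maximality has no larger rank, so the two row spaces agree. *)
set A' := rowsub _ A; pose A2 := \matrix_i L (hx i).
have rA' : \rank A' = d by rewrite -hd; apply/eqP; exact: maxrowsub_free.
have A'A2 : (A' <= A2)%MS.
  apply/row_subP => i; rewrite (_ : row i A' = row (lift ord0 i) A2).
    exact: row_sub.
  by rewrite /A' -A'E !rowK /hx liftK.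
have rA2 : (\rank A2 <= \rank A')%N.
  rewrite rA'; apply: dmax; apply/asboolP; exists (\rank A).+1, hx; split => // i.
  by rewrite /hx; case: unliftP => //= j _; exact: Dh.
have A2A' : (A2 <= A')%MS.
  by rewrite -(mxrank_leqif_sup A'A2) eqn_leq rA2 mxrankS.
rewrite (_ : L x = row ord0 A2); last by rewrite rowK /hx unlift_none.
exact: submx_trans (row_sub _ _) A2A'.
Qed.

Lemma mx_norm_leP (R : realType) m n (u : 'M[R]_(m, n)) (d : R) : 0 <= d ->
  (`|u| <= d) <-> (forall i j, `|u i j| <= d).
Proof.
move=> d0; rewrite /Num.norm/= mx_normrE; split => [/bigmax_leP[_ H] i j|H].
  exact: (H (i, j)).
by apply/bigmax_leP; split => // -[i j] _; exact: H.
Qed.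

(** Completeness in the entrywise sup norm, as the Banach fixed point theorem requires. *)
HB.instance Definition _ (R : realType) m n := Complete.on 'M[R]_(m, n).

Lemma matrix_contraction_fixpoint (R : realType) m n
    (T : 'M[R]_(m, n) -> 'M[R]_(m, n)) (r : R) : 0 <= r ->
  (forall (u v : 'M[R]_(m, n)) (d : R), 0 <= d ->
    (forall i j, `|u i j| <= r) -> (forall i j, `|v i j| <= r) ->
    (forall i j, `|u i j - v i j| <= d) ->
    forall i j, `|T u i j - T v i j| <= d / 2) ->
  (forall i j, `|T 0 i j| <= r / 2) ->
  exists2 u : 'M[R]_(m, n), (forall i j, `|u i j| <= r) & T u = u.
Proof.
move=> r0 Tlip T0.
pose U : set 'M[R]_(m, n) := [set u | `|u| <= r].
have lip u v : U u -> U v -> `|T u - T v| <= 2^-1 * `|u - v|.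
  move=> /(mx_norm_leP _ r0) Uu /(mx_norm_leP _ r0) Uv.
  apply/mx_norm_leP => [|i j]; first by rewrite mulr_ge0.
  rewrite !mxE mulrC; apply: Tlip => // i' j'.
  by have /(mx_norm_leP _ (normr_ge0 _))/(_ i' j') := lexx `|u - v|; rewrite !mxE.
have U0 : U 0 by rewrite /U/= normr0.
(* The ball is preserved: [T u - T 0] contributes at most half the radius by the contraction factor
   1/2, and [T 0] the other half. *)
have funT : set_fun U U T.
  move=> u Uu; rewrite /U/= -[T u](subrK (T 0)).
  rewrite (le_trans (ler_normD _ _))// [leRHS]splitr lerD//.
    rewrite (le_trans (lip _ _ Uu U0))// subr0 mulrC.
    by rewrite ler_wpM2r.
  by apply/mx_norm_leP => //; rewrite divr_ge0.
pose f : {fun U >-> U} := mkfun_fun funT.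
have ctr : is_contraction f.
  exists (2^-1)%:nng; split => /=; first by rewrite invf_lt1 ?ltr1n.
  by move=> [u v] [/= Uu Uv]; exact: lip.
have clU : closed U.
  rewrite /U (_ : mkset _ = (fun u : 'M[R]_(m, n) => `|u|) @^-1` [set x | x <= r]); last by [].
  apply: closed_comp; last exact: closed_le.
  by move=> x _; exact: norm_continuous.
have [u Uu uE] := banach_fixed_point ctr clU (ex_intro _ _ U0).
by exists u; [exact/mx_norm_leP|rewrite [RHS]uE].
Qed.

(** * First-order expansion of the oscillating integrals *)

Section cosine_perturbation.
Context {R : realType}.
Implicit Types (f : R -> R) (a b c q s x y : R).

Lemma is_derive_lipschitz f f' q c a b : (forall x, is_derive x 1 f (f' x)) ->
  (forall x, `|x| <= q -> `|f' x| <= c) -> `|a| <= q -> `|b| <= q ->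
  `|f a - f b| <= c * `|a - b|.
Proof.
move=> df f'c; wlog ab : a b / b <= a => [H aq bq|aq bq].
  have [ba|/ltW ab] := leP b a; first exact: H.
  by rewrite distrC [in leRHS]distrC; exact: H.
have cf : {within `[b, a], continuous f}.
  apply: continuous_subspaceT => x; apply: differentiable_continuous.
  by apply/derivable1_diffP; exact: ex_derive.
have [x xab ->] := MVT_segment ab (fun x _ => df x) cf.
rewrite normrM ler_wpM2r//; apply: f'c.
move: xab aq bq; rewrite in_itv/= !ler_norml => /andP[bx xa] /andP[_ aq] /andP[qb _].
by rewrite (le_trans qb bx) (le_trans xa aq).
Qed.

Lemma sin_lipschitz a b : `|sin a - sin b| <= `|a - b|.
Proof.
rewrite -[leRHS]mul1r.
apply: (@is_derive_lipschitz _ cos (Num.max `|a| `|b|)) => [x _||].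
- by rewrite ler_norml cos_geN1 cos_le1.
- by rewrite le_max lexx.
- by rewrite le_max lexx orbT.
Qed.

Lemma cos_lipschitz a b : `|cos a - cos b| <= `|a - b|.
Proof.
rewrite -[leRHS]mul1r.
apply: (@is_derive_lipschitz _ (fun x => - sin x) (Num.max `|a| `|b|)) => [x _||].
- by rewrite normrN ler_norml sin_geN1 sin_le1.
- by rewrite le_max lexx.
- by rewrite le_max lexx orbT.
Qed.

(** The function cos (s + z) + z sin s has derivative sin s - sin (s + z), which is at most |z| <=
    q. Thus the linearization error is Lipschitz with a constant that shrinks with the
    perturbation. *)
Lemma cos_first_order s q x y : `|x| <= q -> `|y| <= q ->
  `|cos (s + x) - cos (s + y) + sin s * (x - y)| <= q * `|x - y|.
Proof.
move=> xq yq; pose f z := cos (s + z) + sin s * z.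
have -> : cos (s + x) - cos (s + y) + sin s * (x - y) = f x - f y.
  by rewrite /f; ring.
apply: (@is_derive_lipschitz f (fun z => sin s - sin (s + z)) q) => // z.
  have d1 : is_derive z 1 (fun z : R => s + z) 1.
    apply: is_derive_eq (is_deriveD (is_derive_cst _ _ _) (is_derive_id _ _)) _.
    by rewrite add0r.
  have d2 := @is_derive1_comp _ cos (fun z => s + z) _ _ _ (is_derive_cos _) d1.
  have d3 := is_deriveM (is_derive_cst (sin s) z 1) (is_derive_id z 1).
  apply: is_derive_eq (is_deriveD d2 d3) _.
  by rewrite /GRing.scale/= mulr0 addr0 !mulr1 addrC.
move=> zq; apply: le_trans (sin_lipschitz _ _) _.
by rewrite opprD addNKr normrN.
Qed.

(** The flag [i] marks the region where the cutoff equals 1 and the first-order estimate applies.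
    Elsewhere the cosine difference and the linear term are each bounded by |x - y|, a crude bound
    affordable only because F has small mass there. *)
Lemma cutoff_cos_first_order chi (i : bool) c s q x y : 0 <= chi <= 1 ->
  (i -> chi = 1) -> `|x| <= q -> `|y| <= q ->
  `|cos (chi * (s + x) + c) - cos (chi * (s + y) + c) + sin (s + c) * (x - y)|
    <= q * `|x - y| + 2 * `|x - y| * (1 - i%:R).
Proof.
move=> /andP[chi0 chi1] ichi xq yq.
case: i ichi => [->//|_].
  rewrite !mul1r subrr mulr0 addr0 ![s + _ + c]addrAC.
  exact: cos_first_order.
rewrite subr0 mulr1 (le_trans (ler_normD _ _))//.
have H1 : `|cos (chi * (s + x) + c) - cos (chi * (s + y) + c)| <= `|x - y|.
  apply: le_trans (cos_lipschitz _ _) _.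
  rewrite (_ : _ - _ = chi * (x - y)); last by ring.
  by rewrite normrM ger0_norm// ler_piMl.
have H2 : `|sin (s + c) * (x - y)| <= `|x - y|.
  by rewrite normrM ler_piMl// ler_norml sin_geN1 sin_le1.
have H3 : 0 <= q * `|x - y| by rewrite mulr_ge0// (le_trans _ xq).
lra.
Qed.

End cosine_perturbation.

(** * Modulated waves and their resonance with the carrier *)

Section waves.
Context {R : realType} (r : nat).
Variable h : 'I_r -> R -> R.
Hypothesis hs : forall m, smooth (h m).
Hypothesis h1 : forall m t, `|h m t| <= 1.
Implicit Types (l : 'M[R]_(2, r)) (b : 'I_2) (c d k s t : R).
Local Notation mu := (@lebesgue_measure R).

(** The two rows of [l] hold the amplitudes a_m and b_m. With this layout [l *m H] has one row per
    phase, the shape of the system to be solved. *)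
Definition wave l s t : R :=
  \sum_(m < r) (l ord0 m * sin s + l ord_max m * cos s) * h m t.

(* Since cos (x + pi / 2) = - sin x, the phases 0 and pi / 2 encode the real and
   imaginary parts of the equation as two cosine integrals. *)
Definition quarter b : R := if b == ord0 then 0 else pi / 2.

Lemma waveB l l' s t : wave l s t - wave l' s t = wave (l - l') s t.
Proof.
by rewrite /wave -sumrB; apply: eq_bigr => m _; rewrite !mxE; ring.
Qed.

Lemma wave_le l d s t : (forall i j, `|l i j| <= d) ->
  `|wave l s t| <= 2 * r%:R * d.
Proof.
move=> ld; rewrite /wave (le_trans (ler_norm_sum _ _ _))//.
rewrite -mulrA mulrCA [r%:R * _]mulr_natl -[X in _ *+ X]card_ord -sumr_const.
apply: ler_sum => m _; rewrite normrM.
rewrite (le_trans (ler_wpM2l _ (h1 m t)))// mulr1.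
rewrite (le_trans (ler_normD _ _))// mulr_natl mulr2n lerD// normrM.
  by rewrite (le_trans _ (ld ord0 m))// ler_piMr// ler_norml sin_geN1 sin_le1.
by rewrite (le_trans _ (ld ord_max m))// ler_piMr// ler_norml cos_geN1 cos_le1.
Qed.

(* The coefficients of cos 2s and sin 2s left over after extracting the mean of
   the first-order term over a period. *)
Definition cos_coef l b m : R := if b == ord0 then l ord0 m else - l ord_max m.
Definition sin_coef l b m : R := if b == ord0 then - l ord_max m else - l ord0 m.

(** By the double-angle formulas, twice sin (s + phase) times the wave has row b of [l] as its mean
    over a period in s, the phase selecting the row. What remains has frequency exactly 2 and is
    left to the Riemann-Lebesgue lemma. *)
Lemma wave_resonance l b s t :
  \sum_(m < r) l b m * h m t - 2 * (sin (s + quarter b) * wave l s t) =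
  \sum_(m < r) (cos_coef l b m * cos (s + s) + sin_coef l b m * sin (s + s)) * h m t.
Proof.
rewrite /wave !mulr_sumr -sumrB; apply: eq_bigr => m _.
rewrite /quarter /cos_coef /sin_coef.
have c2 : cos s * cos s = 1 - sin s * sin s.
  by rewrite -!expr2 cos2sin2.
have [->|b0] := eqVneq b ord0.
  rewrite addr0 cosD sinD c2; ring.
have -> : b = ord_max by apply/val_inj; case: b b0 => [[|[|[]]]].
rewrite ?(negPf b0).
rewrite cosD !sinD cos_pihalf sin_pihalf.
have -> : sin s * sin s = 1 - cos s * cos s by rewrite c2; ring.
ring.
Qed.

Lemma smooth_wave l k : smooth (fun t => wave l (k * t) t).
Proof.
have sk : smooth (fun t => k * t) by exact: smoothM (@smooth_cst _ _) (@smooth_id _).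
apply: smooth_sum => m; apply: smoothM; last exact: hs.
apply: smoothD; (apply: smoothM; first exact: smooth_cst).
  exact: (smooth_comp (@smooth_sin _)).
exact: (smooth_comp (@smooth_cos _)).
Qed.

Definition tuned (chi : R -> R) k l t := chi t * (k * t + wave l (k * t) t).

Lemma smooth_tuned chi k l : smooth chi -> smooth (tuned chi k l).
Proof.
move=> cs; apply: smoothM => //; apply: smoothD; last exact: smooth_wave.
by apply: smoothM; [exact: smooth_cst|exact: smooth_id].
Qed.

End waves.

Lemma smooth_measurable (R : realType) (f : R -> R) :
  smooth f -> measurable_fun [set: measurableTypeR R] f.
Proof. by move=> fs; apply: continuous_measurable_fun; exact: smooth_continuous. Qed.

(** * Quantitative bounds for one integrable density *)

Section estimates.
Context (R : realType).
Local Notation mu := (@lebesgue_measure R).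
Variable F : measurableTypeR R -> R.
Hypothesis Fi : mu.-integrable setT (EFin \o F).

(** The part a of the bound is charged to the whole mass of F, the part b only to its mass outside
    the interval. *)
Lemma normr_Rintegral_split (W : measurableTypeR R -> R) (M a b : R) :
  0 <= a -> 0 <= b -> measurable_fun setT W ->
  (forall t, `|W t| <= a + b * (1 - \1_`]- M, M] t)) ->
  `|\int[mu]_t (F t * W t)| <=
  a * \int[mu]_t `|F t| + b * \int[mu]_t `|F t - F t * \1_`]- M, M] t|.
Proof.
move=> a0 b0 mW Wab.
have ind01 t : 0 <= (\1_`]- M, M] t : R) <= 1.
  by rewrite indicE; case: (_ \in _); rewrite ?ler01 ?lexx.
have FWi : mu.-integrable setT (EFin \o (fun t => F t * W t)).
  have Wc t : `|W t| <= a + b.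
    by have := Wab t; have := ind01 t; nra.
  exact: (integrable_mul_bounded Fi mW Wc).
have Fti : mu.-integrable setT
    (EFin \o (fun t => `|F t - F t * \1_`]- M, M] t|)).
  apply: integrable_norm; apply: integrable_sub => //.
  apply: (@integrable_mul_bounded _ _ _ _ _ _ 1) => //.
  by move=> t; rewrite ger0_norm; have /andP[] := ind01 t.
have aFi := integrable_scale a (integrable_norm Fi).
have bFi := integrable_scale b Fti.
rewrite -RintegralZl//; last exact: integrable_norm.
rewrite -RintegralZl// -RintegralD//.
apply: le_trans (le_normr_Rintegral measurableT FWi) _.
apply: le_Rintegral => //.
- exact: integrable_norm.
- exact: integrable_add.
move=> t _; rewrite normrM.
rewrite (_ : F t - _ = F t * (1 - \1_`]- M, M] t)); last by ring.
rewrite normrM (ger0_norm (_ : 0 <= 1 - _)).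
  rewrite (le_trans (ler_wpM2l _ (Wab t)))//.
  by rewrite le_eqVlt; apply/orP; left; apply/eqP; ring.
by rewrite subr_ge0; have /andP[] := ind01 t.
Qed.

Section entries.
Variables (r : nat) (h : 'I_r -> R -> R).
Hypothesis hs : forall m, smooth (h m).
Hypothesis h1 : forall m t, `|h m t| <= 1.
Variables (chi : R -> R) (M k A tau delta : R).
Hypothesis chis : smooth chi.
Hypothesis chi01 : forall t, 0 <= chi t <= 1.
Hypothesis chi1 : forall t, `|t| <= M -> chi t = 1.
Hypothesis FA : \int[mu]_t `|F t| <= A.
Hypothesis Ftau : \int[mu]_t `|F t - F t * \1_`]- M, M] t| <= tau.

Let iFM (w : R -> R) (c : R) : smooth w -> (forall t, `|w t| <= c) ->
  mu.-integrable setT (EFin \o (fun t => F t * w t)).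
Proof.
move=> ws wc; have mw := smooth_measurable ws.
exact: (integrable_mul_bounded Fi mw wc).
Qed.

Let smooth_linear : smooth (fun t => k * t).
Proof. by apply: smoothM; [exact: smooth_cst|exact: smooth_id]. Qed.

Let in_itv_chi1 t : t \in `]- M, M]%classic -> chi t = 1.
Proof.
by move=> /set_mem/=; rewrite in_itv/= => /andP[/ltW a b]; apply: chi1; rewrite ler_norml a.
Qed.

(** For [l = 0] the phase is k t wherever the cutoff is 1, so the integral differs from the pure
    oscillation only by a tail, where two cosines differ by at most 2. *)
Lemma entry0_le b : `|\int[mu]_t (F t * cos (k * t + quarter b))| <= delta ->
  `|2 * \int[mu]_t (F t * cos (tuned h chi k 0 t + quarter b))| <=
  2 * delta + 4 * tau.
Proof.
move=> Fd.
have sl : smooth (fun t => cos (k * t + quarter b)).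
  apply: (smooth_comp (@smooth_cos _)).
  by apply: smoothD; [exact: smooth_linear|exact: smooth_cst].
have st : smooth (fun t => cos (tuned h chi k 0 t + quarter b)).
  apply: (smooth_comp (@smooth_cos _)); apply: smoothD; last exact: smooth_cst.
  exact: smooth_tuned.
have cb (x : R) : `|cos x| <= 1 by rewrite ler_norml cos_geN1 cos_le1.
pose W t := cos (tuned h chi k 0 t + quarter b) - cos (k * t + quarter b).
have mW : measurable_fun [set: measurableTypeR R] W.
  exact: (measurable_funB (smooth_measurable st) (smooth_measurable sl)).
have E : \int[mu]_t (F t * cos (tuned h chi k 0 t + quarter b)) =
    \int[mu]_t (F t * W t) + \int[mu]_t (F t * cos (k * t + quarter b)).
  rewrite -RintegralD//; last by apply: (iFM sl) => t; exact: cb.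
    by apply: eq_Rintegral => t _; rewrite /W; ring.
  apply: (@integrable_mul_bounded _ _ _ _ _ _ 2) => // t.
  by rewrite (le_trans (ler_normB _ _))// lerD.
have WB : `|\int[mu]_t (F t * W t)| <= 2 * tau.
  apply: (@le_trans _ _ (0 * \int[mu]_t `|F t| +
      2 * \int[mu]_t `|F t - F t * \1_`]- M, M] t|)).
    apply: normr_Rintegral_split => // t; rewrite add0r indicE.
    have [tM|tM] := boolP (t \in _).
      suff -> : W t = 0 by rewrite normr0 subrr mulr0.
      have w0 : wave h 0 (k * t) t = 0.
        by apply: big1 => m _; rewrite !mxE !mul0r addr0 mul0r.
      by rewrite /W /tuned (in_itv_chi1 tM) mul1r w0 addr0 subrr.
    by rewrite subr0 mulr1 (le_trans (ler_normB _ _))// lerD.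
  by rewrite mul0r add0r ler_wpM2l.
rewrite E normrM ger0_norm// (le_trans (ler_wpM2l _ (ler_normD _ _)))//.
lra.
Qed.

Hypothesis Fcos : forall m,
  `|\int[mu]_t (F t * h m t * cos (k * t + k * t))| <= delta.
Hypothesis Fsin : forall m,
  `|\int[mu]_t (F t * h m t * sin (k * t + k * t))| <= delta.

Let ihm m (w : R -> R) : smooth w -> (forall t, `|w t| <= 1) ->
  mu.-integrable setT (EFin \o (fun t => F t * h m t * w t)).
Proof.
move=> ws wc; have mw := smooth_measurable ws.
have H := integrable_mul_bounded (iFM (@hs m) (h1 m)) mw wc. exact: H.
Qed.

Lemma double_frequency_le (x y : 'I_r -> R) (d : R) :
  (forall m, `|x m| <= d) -> (forall m, `|y m| <= d) ->
  `|\int[mu]_t (F t * \sum_(m < r)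
      (x m * cos (k * t + k * t) + y m * sin (k * t + k * t)) * h m t)| <=
  2 * r%:R * d * delta.
Proof.
move=> xd yd.
have s2 : smooth (fun t => k * t + k * t) by apply: smoothD; exact: smooth_linear.
have ic m : mu.-integrable setT (EFin \o (fun t => F t * h m t * cos (k * t + k * t))).
  apply: ihm => [|t]; first exact: (smooth_comp (@smooth_cos _)).
  by rewrite ler_norml cos_geN1 cos_le1.
have isn m : mu.-integrable setT (EFin \o (fun t => F t * h m t * sin (k * t + k * t))).
  apply: ihm => [|t]; first exact: (smooth_comp (@smooth_sin _)).
  by rewrite ler_norml sin_geN1 sin_le1.
have icx m := integrable_scale (x m) (ic m).
have isy m := integrable_scale (y m) (isn m).
rewrite (_ : Rintegral _ _ _ = \sum_(m < r)
    (x m * \int[mu]_t (F t * h m t * cos (k * t + k * t)) +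
     y m * \int[mu]_t (F t * h m t * sin (k * t + k * t)))).
  rewrite (le_trans (ler_norm_sum _ _ _))//.
  rewrite (_ : 2 * r%:R * d * delta = \sum_(m < r) (d * delta + d * delta)).
    apply: ler_sum => m _; rewrite (le_trans (ler_normD _ _))//.
    by rewrite !normrM lerD// ler_pM.
  by rewrite sumr_const card_ord -mulr_natl; ring.
under eq_bigr do rewrite -RintegralZl// -RintegralZl// -RintegralD//.
rewrite -Rintegral_sum; last by move=> m; exact: integrable_add.
apply: eq_Rintegral => t _; rewrite mulr_sumr; apply: eq_bigr => m _; ring.
Qed.

(** The left side is the defect of [Psi l] from its linear model. It is the integral of F against a
    pointwise linearization error [W] plus the double-frequency remainder [S]. The three terms of
    the constant are the second-order error, the tail and the residual oscillation, made small by
    rho, M and k respectively. *)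
Lemma entryB_le b (l l' : 'M[R]_(2, r)) (rho d : R) : 0 <= rho -> 0 <= d ->
  (forall i j, `|l i j| <= rho) -> (forall i j, `|l' i j| <= rho) ->
  (forall i j, `|l i j - l' i j| <= d) ->
  `|2 * \int[mu]_t (F t * cos (tuned h chi k l t + quarter b)) -
    2 * \int[mu]_t (F t * cos (tuned h chi k l' t + quarter b)) +
    \sum_(m < r) (l b m - l' b m) * \int[mu]_t (F t * h m t)| <=
  d * (8 * r%:R ^+ 2 * rho * A + 8 * r%:R * tau + 2 * r%:R * delta).
Proof.
move=> rho0 d0 lr lr' ld.
have {}ld i j : `|(l - l') i j| <= d by rewrite !mxE.
pose g l := fun t => cos (tuned h chi k l t + quarter b).
have gs l0 : smooth (g l0).
  apply: (smooth_comp (@smooth_cos _)); apply: smoothD; last exact: smooth_cst.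
  exact: smooth_tuned.
have g1 l0 t : `|g l0 t| <= 1 by rewrite ler_norml cos_geN1 cos_le1.
have gi l0 : mu.-integrable setT (EFin \o (fun t => F t * g l0 t)).
  exact: (iFM (gs l0)).
pose S t := \sum_(m < r) (cos_coef (l - l') b m * cos (k * t + k * t) +
  sin_coef (l - l') b m * sin (k * t + k * t)) * h m t.
pose V t := sin (k * t + quarter b) * wave h (l - l') (k * t) t.
have Vs : smooth V.
  apply: smoothM; last exact: smooth_wave.
  apply: (smooth_comp (@smooth_sin _)).
  by apply: smoothD; [exact: smooth_linear|exact: smooth_cst].
pose W t := 2 * (g l t - g l' t + V t).
have mW : measurable_fun [set: measurableTypeR R] W.
  apply: measurable_funM => //; apply: measurable_funD.
    exact: (measurable_funB (smooth_measurable (@gs l)) (smooth_measurable (@gs l'))).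
  exact: (smooth_measurable Vs).
have WB t : `|W t| <= 8 * r%:R ^+ 2 * rho * d + 8 * r%:R * d * (1 - \1_`]- M, M] t).
  (* Here q = 2 r rho bounds both waves, and the wave of [l - l'] is at most 2 r d; the factor 2 in
     [W] leads to 8 r^2 rho d and 8 r d. *)
  have := @cutoff_cos_first_order _ (chi t) (t \in `]- M, M]%classic)
    (quarter b) (k * t) (2 * r%:R * rho) (wave h l (k * t) t)
    (wave h l' (k * t) t) (chi01 t) (@in_itv_chi1 t)
    (wave_le h1 _ _ lr) (wave_le h1 _ _ lr').
  rewrite waveB -/(tuned h chi k l t) -/(tuned h chi k l' t) -/(V t) => H.
  rewrite normrM ger0_norm//.
  apply: (@le_trans _ _ (2 * (2 * r%:R * rho * (2 * r%:R * d) +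
    2 * (2 * r%:R * d) * (1 - (t \in `]- M, M]%classic)%:R)))).
    rewrite ler_wpM2l// (le_trans H)// lerD//.
      by rewrite ler_wpM2l ?mulr_ge0//; exact: wave_le.
    rewrite ler_wpM2r ?subr_ge0//; first by case: (_ \in _).
    by rewrite ler_wpM2l//; exact: wave_le.
  rewrite indicE le_eqVlt; apply/orP; left; apply/eqP; ring.
have Ss : smooth S.
  apply: smooth_sum => m; apply: smoothM; last exact: hs.
  have s2 : smooth (fun t => k * t + k * t) by apply: smoothD; exact: smooth_linear.
  apply: smoothD; (apply: smoothM; first exact: smooth_cst).
    exact: (smooth_comp (@smooth_cos _)).
  exact: (smooth_comp (@smooth_sin _)).
have cd m : `|cos_coef (l - l') b m| <= d.
  by rewrite /cos_coef; case: ifP => _; rewrite ?normrN.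
have sd m : `|sin_coef (l - l') b m| <= d.
  by rewrite /sin_coef; case: ifP => _; rewrite ?normrN.
have Si : mu.-integrable setT (EFin \o (fun t => F t * S t)).
  apply: (@iFM S (\sum_(m < r) (d + d))) => // t.
  rewrite (le_trans (ler_norm_sum _ _ _))//; apply: ler_sum => m _.
  rewrite normrM (le_trans (ler_wpM2l _ (h1 m t)))// mulr1.
  rewrite (le_trans (ler_normD _ _))// !normrM lerD//.
    by rewrite (le_trans _ (cd m))// ler_piMr// ler_norml cos_geN1 cos_le1.
  by rewrite (le_trans _ (sd m))// ler_piMr// ler_norml sin_geN1 sin_le1.
have Wi : mu.-integrable setT (EFin \o (fun t => F t * W t)).
  have Wc t : `|W t| <= 8 * r%:R ^+ 2 * rho * d + 8 * r%:R * d.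
    rewrite (le_trans (WB t))// lerD2l indicE.
    by case: (_ \in _); rewrite ?subrr ?subr0 ?mulr0 ?mulr1// !mulr_ge0.
  exact: (integrable_mul_bounded Fi mW Wc).
have hi m : mu.-integrable setT (EFin \o (fun t => F t * h m t)).
  exact: (iFM (@hs m) (h1 m)).
have lhi m := integrable_scale ((l - l') b m) (hi m).
have -> : 2 * \int[mu]_t (F t * g l t) - 2 * \int[mu]_t (F t * g l' t) +
    \sum_(m < r) (l b m - l' b m) * \int[mu]_t (F t * h m t) =
    \int[mu]_t (F t * W t) + \int[mu]_t (F t * S t).
  have -> : \sum_(m < r) (l b m - l' b m) * \int[mu]_t (F t * h m t) =
      \int[mu]_t \sum_(m < r) (l - l') b m * (F t * h m t).
    rewrite Rintegral_sum//; apply: eq_bigr => m _.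
    by rewrite RintegralZl// !mxE.
  have i2 l0 := integrable_scale 2 (gi l0).
  rewrite -!RintegralZl// -RintegralB// -!RintegralD//; last 2 first.
    exact: integrable_sub.
    exact: integrable_sumr.
  apply: eq_Rintegral => t _.
  have := @wave_resonance _ _ h (l - l') b (k * t) t; rewrite -/(S t) -/(V t) => <-.
  have -> : \sum_(m < r) (l - l') b m * (F t * h m t) =
      F t * \sum_(m < r) (l - l') b m * h m t.
    by rewrite mulr_sumr; apply: eq_bigr => m _; ring.
  by rewrite /W; ring.
have BW : `|\int[mu]_t (F t * W t)| <=
    8 * r%:R ^+ 2 * rho * d * A + 8 * r%:R * d * tau.
  have p1 : 0 <= 8 * r%:R ^+ 2 * rho * d by rewrite !mulr_ge0// exprn_ge0.
  have p2 : 0 <= 8 * r%:R * d by rewrite !mulr_ge0.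
  apply: le_trans (normr_Rintegral_split p1 p2 mW WB) _.
  by rewrite lerD// ler_wpM2l.
have BS := double_frequency_le cd sd.
apply: le_trans (ler_normD _ _) _; apply: le_trans (lerD BW BS) _.
rewrite le_eqVlt; apply/orP; left; apply/eqP; ring.
Qed.

End entries.
End estimates.

(** * Solving for the phase *)

(** For |x| > M + 1 and M >= 0 one has x^2 >= M^2 + 1, so the product vanishes outside a segment. *)
Lemma cutoff_support (R : realType) (chi w : R -> R) (M : R) : 0 <= M ->
  (forall x, M ^+ 2 + 1 <= x ^+ 2 -> chi x = 0) ->
  compactly_supported (fun t => chi t * w t).
Proof.
move=> M0 chi0.
apply: (@subclosed_compact _ _ `[- (M + 1), M + 1]%classic).
- exact: closed_closure.
- exact: segment_compact.
- have /closure_id -> : closed (`[- (M + 1), M + 1]%classic : set R).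
    exact: itv_closed.
  apply: closure_subset => x /=; rewrite in_itv/= -ler_norml.
  apply: contraR; rewrite -ltNge => Mx; rewrite chi0 ?mul0r//.
  rewrite -[leRHS]real_normK ?num_real//.
  by have : 0 <= M by []; nra.
Qed.

Section fixed_point.
Context (R : realType) (n : nat).
Local Notation mu := (@lebesgue_measure R).
Variable F : 'I_n -> measurableTypeR R -> R.
Hypothesis Fi : forall j, mu.-integrable setT (EFin \o F j).

Let cos1 (x : R) : `|cos x| <= 1. Proof. by rewrite ler_norml cos_geN1 cos_le1. Qed.
Let sin1 (x : R) : `|sin x| <= 1. Proof. by rewrite ler_norml sin_geN1 sin_le1. Qed.

Lemma exists_common_tail (e : R) : 0 < e -> exists2 M : R, 0 < M &
  forall j, \int[mu]_t `|F j t - F j t * \1_`]- M, M] t| <= e.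
Proof.
(* A tail bound for the sum of the |F_j| dominates the tail of each of them. *)
move=> e0; pose S t := \sum_(j < n) `|F j t|.
have Si : mu.-integrable setT (EFin \o S).
  by apply: (@integrable_sumr _ (measurableTypeR R)) => j; exact: integrable_norm.
have [M M0 SM] := exists_L1_tail_le e0 Si.
exists M => // j; apply: le_trans SM.
have mB : measurable (`]- M, M]%classic : set (measurableTypeR R)).
  exact: measurable_itv.
have iI (G : measurableTypeR R -> R) : mu.-integrable setT (EFin \o G) ->
    mu.-integrable setT (EFin \o (fun t => `|G t - G t * \1_`]- M, M] t|)).
  move=> Gi; apply: integrable_norm; apply: integrable_sub => //.
  apply: (@integrable_mul_bounded _ _ _ _ _ _ 1) => // t.
  by rewrite indicE; case: (_ \in _); rewrite ?normr1 ?normr0.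
apply: le_Rintegral => //; [exact: iI|exact: iI|].
move=> t _; rewrite indicE; case: (_ \in _); rewrite ?mulr1 ?subrr// !mulr0 !subr0.
rewrite /S [leRHS]ger0_norm ?sumr_ge0// (bigD1 j)//= lerDl.
by rewrite sumr_ge0.
Qed.

Lemma exists_common_frequency r (h : 'I_r -> R -> R) (e : R) :
  (forall m, smooth (h m)) -> (forall m t, `|h m t| <= 1) -> 0 < e ->
  exists k : R,
    [/\ forall j b, `|\int[mu]_t (F j t * cos (k * t + quarter b))| <= e,
        forall j m, `|\int[mu]_t (F j t * h m t * cos (k * t + k * t))| <= e &
        forall j m, `|\int[mu]_t (F j t * h m t * sin (k * t + k * t))| <= e].
Proof.
move=> hs h1 e0.
have Fhi j m : mu.-integrable setT (EFin \o (fun t => F j t * h m t)).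
  exact: (integrable_mul_bounded (Fi j) (smooth_measurable (@hs m)) (h1 m)).
have RLc (G : measurableTypeR R -> R) : mu.-integrable setT (EFin \o G) ->
    \forall k \near \oo, `|\int[mu]_t (G t * cos (k%:R * t))| <= e.
  move=> Gi; have /cvgrPdist_le/(_ _ e0) := @riemann_lebesgue R cos sin
    (smooth_continuous (@smooth_cos R)) cos1 (@is_derive_sin R) sin1 G Gi.
  by apply: filterS => k; rewrite sub0r normrN.
have RLs (G : measurableTypeR R -> R) : mu.-integrable setT (EFin \o G) ->
    \forall k \near \oo, `|\int[mu]_t (G t * sin (k%:R * t))| <= e.
  have dNc (x : R) : is_derive x 1 (fun x => - cos x) (sin x).
    by apply: is_derive_eq (is_deriveN (is_derive_cos x)) _; rewrite opprK.
  have Nc1 (x : R) : `|- cos x| <= 1 by rewrite normrN.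
  move=> Gi; have /cvgrPdist_le/(_ _ e0) := @riemann_lebesgue R (fun x => sin x)
    (fun x => - cos x) (smooth_continuous (@smooth_sin R)) sin1 dNc Nc1 G Gi.
  by apply: filterS => k; rewrite sub0r normrN.
have [N _ HN] : \forall k \near \oo,
    (forall j, `|\int[mu]_t (F j t * cos (k%:R * t))| <= e) /\
    (forall j, `|\int[mu]_t (F j t * sin (k%:R * t))| <= e) /\
    (forall j m, `|\int[mu]_t (F j t * h m t * cos (k%:R * t))| <= e) /\
    (forall j m, `|\int[mu]_t (F j t * h m t * sin (k%:R * t))| <= e).
  near=> k; do !split.
  - by near: k; apply: filter_forall => j; exact: RLc.
  - by near: k; apply: filter_forall => j; exact: RLs.
  - by near: k; do 2 apply: filter_forall => ?; exact: RLc.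
  - by near: k; do 2 apply: filter_forall => ?; exact: RLs.
have [Nc [Ns _]] := HN N (leqnn N).
(* The threshold N serves as the frequency; its double also lies beyond the threshold and controls
   the terms in k t + k t. *)
have [_ [_ [N2c N2s]]] := HN (N + N)%N (leq_addr N N).
exists N%:R; split.
- move=> j b; rewrite /quarter; case: ifP => _.
    by under eq_Rintegral do rewrite addr0.
  under eq_Rintegral do rewrite cosD cos_pihalf sin_pihalf mulr0 mulr1 sub0r.
  under eq_Rintegral do rewrite mulrN -mulN1r.
  rewrite RintegralZl//; first by rewrite mulN1r normrN.
  exact: (integrable_mul_bounded (Fi j)
    (smooth_measurable (smooth_comp (@smooth_sin R)
      (smoothM (@smooth_cst R N%:R) (@smooth_id R)))) (fun t => sin1 _)).
- by move=> j m; under eq_Rintegral do rewrite -mulrDl -natrD.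
- by move=> j m; under eq_Rintegral do rewrite -mulrDl -natrD.
Unshelve. all: by end_near. Qed.

End fixed_point.

Lemma normr_mulmx_le (R : realType) q n r (v : 'M[R]_(q, n)) (P : 'M[R]_(n, r))
    (e : R) i m : 0 <= e -> (forall j, `|v i j| <= e) ->
  `|(v *m P) i m| <= e * \sum_(j < n) \sum_(m' < r) `|P j m'|.
Proof.
move=> e0 ve; rewrite mxE (le_trans (ler_norm_sum _ _ _))// mulr_sumr.
apply: ler_sum => j _; rewrite normrM ler_pM//.
by rewrite (bigD1 m)//= lerDl sumr_ge0.
Qed.

Lemma exists_annihilating_phase (R : realType) n
    (F : 'I_n -> measurableTypeR R -> R) :
  (forall j, (@lebesgue_measure R).-integrable setT (EFin \o F j)) ->
  exists g : R -> R, [/\ smooth g, compactly_supported g,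
    forall j, \int[@lebesgue_measure R]_t (F j t * cos (g t)) = 0 &
    forall j, \int[@lebesgue_measure R]_t (F j t * sin (g t)) = 0].
Proof.
set mu := @lebesgue_measure R => Fi.
pose D (phi : R -> R) := smooth phi /\ forall t, `|phi t| <= 1.
pose L (phi : R -> R) : 'rV[R]_n := \row_j \int[mu]_t (F j t * phi t).
have [r [h [Dh]]] := exists_spanning_free_family D L.
set H := \matrix_m L (h m) => freeH spanH.
have hs m : smooth (h m) by have [] := Dh m.
have h1 m t : `|h m t| <= 1 by have [_] := Dh m; exact.
(* A right inverse of [H], whose rows are free. [C] bounds its effect on entries, the summand 1
   keeping it positive, and [eta] is chosen so that [eta * C] is 1/2. *)
pose P := pinvmx H.
pose C := 1 + \sum_(j < n) \sum_(m < r) `|P j m|.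
have C0 : 0 < C by rewrite ltr_pwDl// sumr_ge0// => j _; exact: sumr_ge0.
pose eta := (2 * C)^-1.
have eta0 : 0 < eta by rewrite invr_gt0 mulr_gt0.
pose A := 1 + \sum_(j < n) \int[mu]_t `|F j t|.
have FA j : \int[mu]_t `|F j t| <= A.
  rewrite /A (bigD1 j)//= addrCA lerDl addr_ge0// sumr_ge0// => i _.
  exact: Rintegral_ge0.
have A0 : 0 < A.
  by rewrite ltr_pwDl// sumr_ge0// => i _; exact: Rintegral_ge0.
pose B := 8 * r%:R ^+ 2 * A + 1.
have B0 : 0 < B by rewrite ltr_wpDl// !mulr_ge0// ?exprn_ge0// ltW.
(* This choice holds the second-order error to eta / 3. The tail and oscillation errors are each at
   most [e]: the bound eta / 3 on [e] completes the contraction estimate, and the bound eta rho / 2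
   keeps [T 0] in the half ball. *)
pose rho := eta / (3 * B).
have rho0 : 0 < rho by rewrite divr_gt0// mulr_gt0.
have rhoB : 8 * r%:R ^+ 2 * rho * A <= eta / 3.
  have -> : eta / 3 = rho * B by rewrite /rho; field; rewrite gt_eqF.
  have -> : rho * B = 8 * r%:R ^+ 2 * rho * A + rho by rewrite /B; ring.
  by rewrite lerDl ltW.
pose e := Num.min (eta / 3) (eta * rho / 2).
have e0 : 0 < e by rewrite lt_min !divr_gt0// mulr_gt0.
have e1 : e <= eta / 3 by rewrite ge_min lexx.
have e2 : e <= eta * rho / 2 by rewrite ge_min lexx orbT.
have r0 : 0 <= r%:R :> R by [].
pose tau := e / (8 * r%:R + 4).
have tau_d : 0 < 8 * r%:R + 4 :> R by lra.
have tau0 : 0 < tau by rewrite divr_gt0.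
have tauE : 8 * r%:R * tau + 4 * tau = e by rewrite /tau; field; rewrite gt_eqF.
pose delta := e / (2 * r%:R + 2).
have delta_d : 0 < 2 * r%:R + 2 :> R by lra.
have delta0 : 0 < delta by rewrite divr_gt0.
have deltaE : 2 * r%:R * delta + 2 * delta = e by rewrite /delta; field; rewrite gt_eqF.
have [M M0 Mtau] := exists_common_tail Fi tau0.
have [chi [chis chi01 chi1 chi0]] := exists_smooth_cutoff M.
have [k [kq kc ks]] := exists_common_frequency Fi hs h1 delta0.
pose Psi (l : 'M[R]_(2, r)) : 'M[R]_(2, n) :=
  \matrix_(b, j) (2 * \int[mu]_t (F j t * cos (tuned h chi k l t + quarter b))).
(* Psi l is to first order - l *m H, so T is to first order constant. *)
pose T l := l + Psi l *m P.
have Tlip (u v : 'M[R]_(2, r)) (d : R) : 0 <= d ->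
    (forall i j, `|u i j| <= rho) -> (forall i j, `|v i j| <= rho) ->
    (forall i j, `|u i j - v i j| <= d) ->
    forall i j, `|T u i j - T v i j| <= d / 2.
  move=> d0 ur vr uv i m.
  (* Since [H *m P] is the identity, [E *m P] is exactly [T u - T v], and [E] is the defect
     estimated by [entryB_le]. *)
  pose E := Psi u - Psi v + (u - v) *m H.
  have -> : T u i m - T v i m = (E *m P) i m.
    rewrite /E mulmxDl mulmxBl -mulmxA mulmxVp// mulmx1.
    by rewrite /T !mxE; ring.
  have Ei j : `|E i j| <= d * eta.
    have := entryB_le (Fi j) hs h1 chis chi01 chi1 (FA j) (Mtau j) (kc j) (ks j)
      i (ltW rho0) d0 ur vr uv.
    rewrite (_ : _ + _ = E i j); last first.
      rewrite !mxE; congr (_ + _); apply: eq_bigr => m' _.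
      by rewrite !mxE.
    move/le_trans; apply; rewrite ler_wpM2l//.
    by have t4 := ltW tau0; have d4 := ltW delta0; lra.
  apply: le_trans (@normr_mulmx_le _ _ _ _ _ P _ _ m (mulr_ge0 d0 (ltW eta0)) Ei) _.
  have -> : d / 2 = d * eta * C by rewrite /eta; field; rewrite gt_eqF.
  apply: ler_wpM2l; last by rewrite /C lerDr.
  exact: mulr_ge0 d0 (ltW eta0).
have T0 i j : `|T 0 i j| <= rho / 2.
  rewrite /T add0r.
  have Ei j' : `|Psi 0 i j'| <= eta * rho.
    rewrite mxE.
    have := entry0_le (Fi j') hs chis chi1 (Mtau j') (kq j' i).
    move/le_trans; apply.
    by have t4 := ltW tau0; have d4 := ltW delta0; nra.
  apply: le_trans
    (@normr_mulmx_le _ _ _ _ _ P _ _ j (mulr_ge0 (ltW eta0) (ltW rho0)) Ei) _.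
  have -> : rho / 2 = eta * rho * C by rewrite /eta; field; rewrite gt_eqF.
  apply: ler_wpM2l; last by rewrite /C lerDr.
  exact: mulr_ge0 (ltW eta0) (ltW rho0).
have [l _ Tl] := matrix_contraction_fixpoint (ltW rho0) Tlip T0.
have gs : smooth (tuned h chi k l) by exact: smooth_tuned.
have Psi0 : Psi l = 0.
  have PsiP : Psi l *m P = 0.
    by move: Tl; rewrite /T -[RHS]addr0 => /addrI.
  (* Each row of [Psi l] is twice the value of [L] at an admissible function, hence lies in the span
     of the rows of [H]; there [P] followed by [H] is the identity, so [Psi l *m P = 0] forces
     [Psi l = 0]. *)
  have PsiH : (Psi l <= H)%MS.
    apply/row_subP => b.
    rewrite (_ : row b _ = 2 *: L (fun t => cos (tuned h chi k l t + quarter b))).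
      apply: scalemx_sub; apply: spanH; split.
        apply: (smooth_comp (@smooth_cos _)).
        by apply: smoothD; [exact: gs|exact: smooth_cst].
      by move=> t; rewrite ler_norml cos_geN1 cos_le1.
    by apply/rowP => j; rewrite !mxE.
  by rewrite -(mulmxKpV PsiH) PsiP mul0mx.
have I0 b j : \int[mu]_t (F j t * cos (tuned h chi k l t + quarter b)) = 0.
  have /matrixP/(_ b j) := Psi0; rewrite !mxE => /eqP.
  by rewrite mulf_eq0 pnatr_eq0 /= => /eqP.
exists (tuned h chi k l); split => //.
- exact: (@cutoff_support _ chi (fun t => k * t + wave h l (k * t) t) _
    (ltW M0) chi0).
- move=> j; rewrite -(I0 ord0 j); apply: eq_Rintegral => t _.
  by rewrite /quarter eqxx addr0.
- move=> j; apply/eqP; rewrite -oppr_eq0 -mulN1r -RintegralZl//.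
    rewrite -(I0 ord_max j); apply/eqP; apply: eq_Rintegral => t _.
    by rewrite /quarter /= cosD cos_pihalf sin_pihalf; ring.
  have s1 t : `|sin (tuned h chi k l t)| <= 1.
    by rewrite ler_norml sin_geN1 sin_le1.
  exact: (integrable_mul_bounded (Fi j)
    (smooth_measurable (smooth_comp (@smooth_sin R) gs)) s1).
Qed.

(** The real and imaginary parts test each f_j against cos g and sin g of the first coordinate, so
    the marginal densities reduce everything to the one-dimensional system. *)
Theorem corollary1p2 (R : realType) (N n : nat) (hN : (0 < N)%N) (hn : (0 < n)%N)
    (f : 'I_n -> N.-tuple R -> R)
    (hf : forall j : 'I_n, (lebesgueN N).-integrable setT (EFin \o f j)) :
  exists g : R -> R,
    smooth g /\ compactly_supported g /\
    forall j : 'I_n,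
      Cintegral (lebesgueN N) setT
        (fun x => (f j x)%:C%C * cexp ('i%C * (g (tnth x (Ordinal hN)))%:C%C)) = 0.
Proof.
pose F0 j := cid2 (lebesgueN_marginal (Ordinal hN) (hf j)).
pose F j : measurableTypeR R -> R := s2val (F0 j).
have Fi j : (@lebesgue_measure R).-integrable setT (EFin \o F j).
  exact: s2valP (F0 j).
have fF j := s2valP' (F0 j).
have [g [gs gc gcos gsin]] := exists_annihilating_phase Fi.
exists g; split; [exact: gs|split; [exact: gc|move=> j]].
have expig (x y : R) : x%:C%C * cexp ('i%C * y%:C%C) =
    Complex (x * cos y) (x * sin y).
  rewrite /cexp /= !(mul0r, mul1r, mulr0, subrr, addr0, add0r) oppr0 expR0 !mul1r.
  by apply/eqP; rewrite eq_complex /= !mul0r subr0 addr0 !eqxx.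
rewrite /Cintegral; under eq_Rintegral do rewrite expig /=.
under [X in Complex _ X]eq_Rintegral do rewrite expig /=.
rewrite (fF j (cos \o g) 1); last 2 first.
- exact: (smooth_measurable (smooth_comp (@smooth_cos R) gs)).
- by move=> t /=; rewrite ler_norml cos_geN1 cos_le1.
rewrite (fF j (fun t => sin (g t)) 1); last 2 first.
- exact: (smooth_measurable (smooth_comp (@smooth_sin R) gs)).
- by move=> t /=; rewrite ler_norml sin_geN1 sin_le1.
by rewrite [X in Complex X _]gcos gsin.
Qed.
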